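(* Let $\alpha\in(0,1)$, $T>0$, $N\ge 1$ an integer, $\Delta t=T/N$. Let $(u^n)_{0\le n\le N}$ (periodic functions on $\Omega$) and $(r^n)_{0\le n\le N}$ (real numbers) satisfy, for every $1\le n\le N$, the second order L2 SAV scheme $$L_n^\alpha u=\mathcal G\left[\mathcal L u^{n}+\frac{r^{n}}{\sqrt{E_1(\overline u^{n})}}\,\delta_uE_1(\overline u^{n})\right],$$ $$3r^{n}-4r^{n-1}+r^{n-2}=\frac{1}{2\sqrt{E_1(\overline u^{n})}}\left\langle \delta_uE_1(\overline u^{n}),\,3u^{n}-4u^{n-1}+u^{n-2}\right\rangle,$$ where $\overline u^{n}=2u^{n-1}-u^{n-2}$, with the conventions $u^{-1}=u^0$, $r^{-1}=r^0$. Define $$\widetilde E^{n}=\frac14\Big(\langle u^n,\mathcal L u^n\rangle+\langle 2u^n-u^{n-1},\mathcal L(2u^n-u^{n-1})\rangle\Big)+\frac12\Big((r^n)^2+(2r^n-r^{n-1})^2\Big).$$ Then for all $1\le n\le N$, $$\widetilde E^{n}\le \widetilde E^{0}.$$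
   Context: $\Omega$ is a bounded box with periodic boundary conditions; $\langle\cdot,\cdot\rangle$ is the (real) $L^2(\Omega)$ inner product. The scheme is a time discretization of the time-fractional phase-field equation $\partial_t^\alpha u=\mathcal G\,\delta_uE(u)$ with Caputo derivative $\partial_t^\alpha$, where $\mathcal G$ is a linear, self-adjoint, nonpositive operator depending on the model (e.g. $\mathcal G=-1$ for Allen--Cahn, $\mathcal G=\Delta$ for Cahn--Hilliard), and the energy is split as $E(u)=\frac12\langle u,\mathcal Lu\rangle+E_1(u)$ with $\mathcal L$ a linear, self-adjoint, nonnegative operator (e.g. $\mathcal L=-\varepsilon^2\Delta$) and $E_1$ a functional, positive where it is evaluated, with functional derivative $\delta_uE_1$. The scalar $r^n$ is the scalar auxiliary variable approximating $\sqrt{E_1(u)}$. The functions $u^n$ are assumed regular enough that all terms make sense. The L2 operator: for a sequence $(u^k)$, $$L_1^\alpha u=\frac{1}{\Gamma(2-\alpha)\Delta t^\alpha}(u^1-u^0),$$ and for $k\ge2$, $$L_k^\alpha u=\frac{1}{\Gamma(3-\alpha)\Delta t^\alpha}\Big\{\sum_{j=1}^{k-1}\big(a_ju^{k-j-1}+b_ju^{k-j}+c_ju^{k-j+1}\big)+\frac\alpha2u^{k-2}-2u^{k-1}+\frac{4-\alpha}{2}u^k\Big\},$$ where $a_j=-\frac32(2-\alpha)(j+1)^{1-\alpha}+\frac12(2-\alpha)j^{1-\alpha}+(j+1)^{2-\alpha}-j^{2-\alpha}$, $b_j=2(2-\alpha)(j+1)^{1-\alpha}-2(j+1)^{2-\alpha}+2j^{2-\alpha}$,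 $c_j=-\frac12(2-\alpha)\big((j+1)^{1-\alpha}+j^{1-\alpha}\big)+(j+1)^{2-\alpha}-j^{2-\alpha}$. *)

(* Defs.v *)
From HB Require Import structures.
From mathcomp Require Import all_boot all_order all_algebra.
From mathcomp Require Import all_classical all_reals all_analysis.

Set Implicit Arguments.
Unset Strict Implicit.
Unset Printing Implicit Defensive.

Import Order.TTheory GRing.Theory Num.Theory.
Import numFieldNormedType.Exports.

Local Open Scope classical_set_scope.
Local Open Scope ring_scope.

Section cons_measure.
Context {R : realType} (d : nat).

Definition cons_coord (p : R * d.-tuple R) : d.+1.-tuple R :=
  [tuple of p.1 :: p.2].

Lemma measurable_cons_coord : measurable_fun [set: R * d.-tuple R] cons_coord.
Proof. exact: measurable_cons. Qed.

Variable m : {sigma_finite_measure set (d.-tuple R) -> \bar R}.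

Definition cons_measure : set (d.+1.-tuple R) -> \bar R :=
  pushforward (@lebesgue_measure R \x m)%E cons_coord.

Let cons_measure0 : cons_measure set0 = 0%E.
Proof. by rewrite /cons_measure /pushforward preimage_set0 measure0. Qed.

Let cons_measure_ge0 A : (0 <= cons_measure A)%E.
Proof. by apply: (measure_ge0 (@lebesgue_measure R \x m)%E). Qed.

Let cons_measure_sigma_additive : semi_sigma_additive cons_measure.
Proof.
exact: (@measure_semi_sigma_additive _ _ _
  (measure_function_pushforward__canonical__measure_function_Measure
     (@lebesgue_measure R \x m)%E measurable_cons_coord)).
Qed.

HB.instance Definition _ := isMeasure.Build _ _ _ cons_measure
  cons_measure0 cons_measure_ge0 cons_measure_sigma_additive.


Lemma cons_measure_sigma_finite :
  sigma_finite [set: d.+1.-tuple R] cons_measure.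
Proof.
have /sigma_finiteP[F [FT ndF Foo]] := sigma_finiteT (@lebesgue_measure R).
have /sigma_finiteP[G [GT ndG Goo]] := sigma_finiteT m.
pose uncons (t : d.+1.-tuple R) : R * d.-tuple R :=
  (tnth t ord0, [tuple of behead t]).
have muncons : measurable_fun [set: d.+1.-tuple R] uncons.
  by apply: measurable_fun_pair; [exact: measurable_tnth|
                                  exact: measurable_behead].
exists (fun k => uncons @^-1` (F k `*` G k)).
  apply/esym; rewrite -subTset => t _.
  have : [set: R] (uncons t).1 by [].
  rewrite FT => -[k _ Fk].
  have : [set: d.-tuple R] (uncons t).2 by [].
  rewrite GT => -[l _ Gl].
  exists (maxn k l) => //; split => /=.
    by have /subsetPset FS := ndF _ _ (leq_maxl k l); exact: FS.
  by have /subsetPset GS := ndG _ _ (leq_maxr k l); exact: GS.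
move=> k; have [mF Fk] := Foo k; have [mG Gk] := Goo k; split.
  by rewrite -[X in measurable X]setTI; apply: muncons => //; exact: measurableX.
rewrite /cons_measure /pushforward -comp_preimage.
rewrite (_ : uncons \o cons_coord = id); last first.
  by apply/funext => -[x t]; congr pair; apply: val_inj.
rewrite preimage_id product_measure1E//.
by rewrite lte_mul_pinfty// ge0_fin_numE.
Qed.

HB.instance Definition _ := Measure_isSigmaFinite.Build _ _ _ cons_measure
  cons_measure_sigma_finite.

End cons_measure.

Section lebesgue_tuple.
Context {R : realType}.

Lemma dirac0_sigma_finite :
  sigma_finite [set: 0.-tuple R] (dirac [tuple] : set (0.-tuple R) -> \bar R).
Proof.
exists (fun=> setT); first by rewrite bigcup_const.
by move=> _; split => //; rewrite diracT ltry.
Qed.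

Fixpoint lebesgue_tuple (d : nat) :
    {sigma_finite_measure set (d.-tuple R) -> \bar R} :=
  if d is d'.+1 then cons_measure (lebesgue_tuple d')
  else @dirac _ (0.-tuple R) [tuple] R.

Lemma lebesgue_tupleE (d : nat) (A : 'I_d -> set R) :
  (forall i, measurable (A i)) ->
  lebesgue_tuple d [set x | forall i, A i (tnth x i)] =
  (\prod_(i < d) lebesgue_measure (A i))%E.
Proof.
elim: d A => [A _|d IHd A mA].
  by rewrite big_ord0 /= diracE mem_set// => -[].
rewrite big_ord_recl -IHd; last by move=> i; exact: mA.
have mtl : measurable [set x : d.-tuple R | forall i, A (lift ord0 i) (tnth x i)].
  rewrite [X in measurable X](_ : _ = \big[setI/setT]_(i < d)
      ((fun t => tnth t i) @^-1` A (lift ord0 i))).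
    apply: bigsetI_measurable => i _; rewrite -[X in measurable X]setTI.
    exact: measurable_tnth.
  apply/seteqP; split => x /=.
    move=> Ax; apply: (big_ind (fun B : set (d.-tuple R) => B x)) => //.
    by move=> i _; exact: Ax.
  rewrite -bigcap_seq /= => Ax i.
  by apply: (Ax i) => /=; rewrite mem_index_enum.
rewrite -product_measure1E//; last exact: (mA ord0).
rewrite /= /cons_measure /pushforward; congr (_ _).
apply/seteqP; split => -[x t] /=.
  move=> H; split; first exact: (H ord0).
  by move=> i; have := H (lift ord0 i); rewrite tnthS.
move=> [Ax At] i; case: (unliftP ord0 i) => [j|] ->; last exact: Ax.
by rewrite tnthS; exact: At.
Qed.

End lebesgue_tuple.

Section periodic_L2.
Context {R : realType} {d : nat}.
Variables lo hi : 'I_d -> R.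
Local Notation mu := (@lebesgue_tuple R d).
Implicit Types (f g phi : d.-tuple R -> R) (D : set (d.-tuple R -> R)).
Implicit Types A : (d.-tuple R -> R) -> (d.-tuple R -> R).

Definition box : set (d.-tuple R) :=
  [set x | forall i, lo i <= tnth x i <= hi i].

Definition period_shift (i : 'I_d) (x : d.-tuple R) : d.-tuple R :=
  [tuple tnth x j + (if j == i then hi i - lo i else 0) | j < d].

Definition periodic f := forall i x, f (period_shift i x) = f x.

(* Functions rather than classes modulo null sets; equality in L^2 is the
   library's [f = g %[ae mu in box]]. *)
Definition L2per : set (d.-tuple R -> R) :=
  [set f | [/\ measurable_fun [set: d.-tuple R] f, periodic f
             & mu.-integrable box (fun x => (f x ^+ 2)%:E)]].

Definition inner f g : R := \int[mu]_(x in box) (f x * g x).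

Definition dense_subspace D :=
  [/\ D `<=` L2per, D (fun=> 0),
      forall (c : R) f g, D f -> D g -> D (fun x => c * f x + g x)
    & forall f, L2per f -> forall e : R, 0 < e ->
        exists2 phi, D phi & inner (fun x => f x - phi x)
                                   (fun x => f x - phi x) < e].

(* A densely defined, possibly unbounded, linear operator of L^2; [A] is
   irrelevant outside its domain [D], and is linear modulo null sets only. *)
Definition linear_operator D A :=
  [/\ dense_subspace D,
      forall f, D f -> L2per (A f)
    & forall (c : R) f g, D f -> D g ->
        A (fun x => c * f x + g x) = (fun x => c * A f x + A g x)
          %[ae mu in box]].

(* Symmetry on the domain.  The domain of the adjoint is not
   required to be [D], so that [D] may be any class of regular functions, such
   as the smooth ones for a differential operator. *)
Definition formally_self_adjoint D A :=
  forall f g, D f -> D g -> inner (A f) g = inner f (A g).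

Definition nonneg_operator D A := forall f, D f -> 0 <= inner f (A f).

Definition nonpos_operator D A := forall f, D f -> inner f (A f) <= 0.

(* [g] represents the first variation of [E] at [v] along the directions of
   [D]; it is determined modulo null sets when [D] is dense. *)
Definition functional_derivative D (E : (d.-tuple R -> R) -> R)
    (v g : d.-tuple R -> R) :=
  L2per g /\
  forall phi, D phi ->
    is_derive (0 : R) (1 : R) (fun s : R => E (fun x => v x + s * phi x))
      (inner g phi).

End periodic_L2.

Section L2_operator.
Context {R : realType}.

Definition Gamma (s : R) : R :=
  \int[lebesgue_measure]_(t in `[0, +oo[) (t `^ (s - 1) * expR (- t)).

Variable alpha : R.

Definition L2_a (j : nat) : R :=
  - (3 / 2) * (2 - alpha) * j.+1%:R `^ (1 - alpha)
  + 1 / 2 * (2 - alpha) * j%:R `^ (1 - alpha)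
  + j.+1%:R `^ (2 - alpha) - j%:R `^ (2 - alpha).

Definition L2_b (j : nat) : R :=
  2 * (2 - alpha) * j.+1%:R `^ (1 - alpha)
  - 2 * j.+1%:R `^ (2 - alpha) + 2 * j%:R `^ (2 - alpha).

Definition L2_c (j : nat) : R :=
  - (1 / 2) * (2 - alpha) * (j.+1%:R `^ (1 - alpha) + j%:R `^ (1 - alpha))
  + j.+1%:R `^ (2 - alpha) - j%:R `^ (2 - alpha).

(* Acts on scalar sequences, hence pointwise on sequences of functions.  The
   operator is only used for [k >= 1]; the value at [k = 0] is a dummy. *)
Definition L2_op (dt : R) (v : nat -> R) (k : nat) : R :=
  match k with
  | 0 => 0
  | 1 => (Gamma (2 - alpha) * dt `^ alpha)^-1 * (v 1%N - v 0%N)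
  | _ => (Gamma (3 - alpha) * dt `^ alpha)^-1 *
         (\sum_(1 <= j < k) (L2_a j * v (k - j - 1)%N + L2_b j * v (k - j)%N
                             + L2_c j * v (k - j + 1)%N)
          + alpha / 2 * v (k - 2)%N - 2 * v (k - 1)%N
          + (4 - alpha) / 2 * v k)
  end.

End L2_operator.

(* Truncated subtraction on [nat] implements the conventions u^{-1} = u^0 and
   r^{-1} = r^0: for [n = 1], [n - 2] is [0], and for [n = 0], [n - 1] is [0]. *)
Section sav.
Context {R : realType} {d : nat}.
Variables (u : nat -> d.-tuple R -> R) (r : nat -> R).

Definition extrapolation (n : nat) : d.-tuple R -> R :=
  fun x => 2 * u (n - 1)%N x - u (n - 2)%N x.

Definition bdf2 (n : nat) : d.-tuple R -> R :=
  fun x => 3 * u n x - 4 * u (n - 1)%N x + u (n - 2)%N x.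

Definition modified_energy (lo hi : 'I_d -> R)
    (L : (d.-tuple R -> R) -> (d.-tuple R -> R)) (n : nat) : R :=
  let w : d.-tuple R -> R := fun x => 2 * u n x - u (n - 1)%N x in
  1 / 4 * (inner lo hi (u n) (L (u n)) + inner lo hi w (L w))
  + 1 / 2 * (r n ^+ 2 + (2 * r n - r (n - 1)%N) ^+ 2).

End sav.

(* Main.v *)
Require Import Defs.
From mathcomp Require Import all_boot all_order all_algebra.
From mathcomp Require Import all_classical all_reals all_analysis.
From mathcomp Require Import measurable_realfun ring lra.

Import Order.TTheory GRing.Theory Num.Theory.
Import numFieldNormedType.Exports.

Local Open Scope classical_set_scope.
Local Open Scope ring_scope.

(** Why the energy is dissipated.

    Write mu_n for the bracket on which G acts and B_n u for the BDF2
    difference 3 u^n - 4 u^(n-1) + u^(n-2).  Testing mu_n against B_n u, the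
    identity

      2 a (3 a - 4 b + c) = a^2 + (2a - b)^2 - b^2 - (2b - c)^2 + (a - 2b + c)^2

    in its scalar form for r and its operator form for the nonnegative L
    ([g_norm_dissipation], [r_dissipation]) gives
    2 (E~^n - E~^(n-1)) <= <mu_n, B_n u>, so it suffices to show that the sum
    over n of <mu_n, B_n u> is nonpositive.

    The L2 operator is a lower triangular matrix A, with positive diagonal,
    acting on the increments of u, so B u = P (A u) for some matrix P, and
    A u = G mu by the scheme.  The sum is therefore that of
    P_nm <mu_n, G mu_m>.  The matrix of -<mu_n, G mu_m> is symmetric positive
    semidefinite, so this sum is nonpositive as soon as the quadratic form of P
    is nonnegative ([pairing_nonneg_forms_ge0]: the trace pairing of two
    nonnegative forms).  Inverting A in this way avoids any inverse of G, whose
    kernel may be nontrivial.  Substituting y = A u, nonnegativity of P is the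
    scalar inequality

      sum over n of (A v)_n (3 v_n - 4 v_(n-1) + v_(n-2)) >= 0

    for every real sequence v ([L2_kernel_bdf2_ge0]).

    For this inequality A is split as follows.  With e_j = - a_j and c_j as in
    the L2 operator, the coefficients are e_(n-j) + c_(n-j+1) away from the
    first increment and e_(n-1) on the first one, up to the short-range term
    alpha x_n - (alpha / 2) x_(n-1), which has a nonnegative form of its own
    ([local_term_bdf2_ge0]).  With F(s) = s^(2-alpha), e_j is a weighted mean of
    F'' over [j, j+1] and c_j is the error of the trapezoidal rule for F'.  Since
    F'' is a completely monotone function, e and c are completely monotone
    sequences ([L2_a_monotone], [L2_c_monotone]).  For a triangular
    kernel whose differences have the signs that complete monotonicity
    provides, a discrete energy in the BDF2 norm is dissipated
    ([kernel_energy]); monotonicity up to the third difference is enough.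

    The coefficient of the first step is normalized by Gamma(2-alpha) and the
    others by Gamma(3-alpha); the functional equation of Gamma ([GammaS]) makes
    them comparable. *)

Set Implicit Arguments.
Unset Strict Implicit.
Unset Printing Implicit Defensive.

(** * Nonnegative quadratic forms *)

Section PositiveForms.
Context {R : realFieldType}.

Lemma sum2_ord_recr n (f : 'I_n.+1 -> 'I_n.+1 -> R) :
  let w := widen_ord (leqnSn n) in
  \sum_i \sum_j f i j = \sum_i \sum_j f (w i) (w j)
    + \sum_i (f (w i) ord_max + f ord_max (w i)) + f ord_max ord_max.
Proof.
rewrite /= big_ord_recr /=; under eq_bigr do rewrite big_ord_recr /=.
by rewrite big_split /= [in X in _ + X]big_ord_recr /= big_split /= !addrA.
Qed.

(** The trace of a product of two positive semidefinite matrices, only one of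
    which is symmetric.  Eliminating the last variable by a Schur complement
    writes [M] as a nonnegative form in fewer variables plus a square. *)
Lemma pairing_nonneg_forms_ge0 n (P M : 'I_n -> 'I_n -> R) :
  (forall y : nat -> R, 0 <= \sum_i \sum_j P i j * (y i * y j)) ->
  (forall i j, M i j = M j i) ->
  (forall y : nat -> R, 0 <= \sum_i \sum_j M i j * (y i * y j)) ->
  0 <= \sum_i \sum_j P i j * M i j.
Proof.
elim: n P M => [|n IH] P M Pge0 Msym Mge0; first by rewrite big_ord0.
pose w := widen_ord (leqnSn n); pose m := M ord_max ord_max.
pose a (i : 'I_n) := M (w i) ord_max.
pose ext (z : nat -> R) (s : R) (i : nat) := if i == n then s else z i.
have extw z s (i : 'I_n) : ext z s (w i) = z i by rewrite /ext /= ltn_eqF.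
have extn z s : ext z s (@ord_max n) = s by rewrite /ext /= eqxx.
have form (Q : 'I_n.+1 -> 'I_n.+1 -> R) (z : nat -> R) s :
    \sum_i \sum_j Q i j * (ext z s i * ext z s j)
    = \sum_(i < n) \sum_(j < n) Q (w i) (w j) * (z i * z j)
      + s * \sum_(i < n) (Q (w i) ord_max + Q ord_max (w i)) * z i
      + Q ord_max ord_max * s ^+ 2.
  rewrite sum2_ord_recr -/w !extn mulr_sumr; congr (_ + _ + _).
  - by apply: eq_bigr => i _; apply: eq_bigr => j _; rewrite !extw.
  - by apply: eq_bigr => i _; rewrite !extw; ring.
have PW (z : nat -> R) : 0 <= \sum_(i < n) \sum_(j < n) P (w i) (w j) * (z i * z j).
  by have := Pge0 (ext z 0); rewrite form; rewrite mul0r expr0n mulr0 !addr0.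
have Mform (z : nat -> R) s : 0 <= \sum_(i < n) \sum_(j < n) M (w i) (w j) * (z i * z j)
      + 2 * s * (\sum_(i < n) a i * z i) + m * s ^+ 2.
  have := Mge0 (ext z s); rewrite form (_ : s * _ = 2 * s * \sum_(i < n) a i * z i) //.
  rewrite !mulr_sumr; apply: eq_bigr => i _.
  by rewrite -(Msym (w i) ord_max) /a; ring.
have m_ge0 : 0 <= m.
  have := Mform (fun=> 0) 1; rewrite [X in X + _ + _]big1 ?add0r; last first.
    by move=> i _; rewrite big1 // => j _; rewrite !mulr0.
  by rewrite [X in _ * X]big1 ?mulr0 ?add0r ?expr1n ?mulr1 // => i _; rewrite mulr0.
rewrite sum2_ord_recr -/w -/m.
have toseq (b : 'I_n -> R) : exists z : nat -> R, forall i : 'I_n, z i = b i.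
  exists (fun k => if insub k is Some i then b i else 0) => i.
  by rewrite valK.
have [za zaE] := toseq a.
move: m_ge0; rewrite le_eqVlt => /predU1P[m0|m_gt0].
- have a0 i : a i = 0.
    (* The form of M is affine in the last coordinate and bounded below, so the
       slope, taken at a itself, vanishes. *)
    have sq : \sum_(i < n) a i * za i = \sum_(i < n) a i ^+ 2.
      by apply: eq_bigr => j _; rewrite zaE expr2.
    set q := \sum_(i < n) \sum_(j < n) M (w i) (w j) * (za i * za j).
    have S0 : \sum_(i < n) a i ^+ 2 <= 0.
      rewrite leNgt; apply/negP => S_gt0.
      have := Mform za (- (q + 1) / (2 * \sum_(i < n) a i ^+ 2)).
      rewrite -m0 mul0r addr0 sq -/q mulrAC mulrCA mulfV ?mulr1; last first.
        by rewrite mulf_neq0 ?pnatr_eq0 // gt_eqF.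
      by lra.
    have : \sum_(i < n) a i ^+ 2 == 0.
      by rewrite eq_le S0 sumr_ge0 // => j _; rewrite sqr_ge0.
    rewrite psumr_eq0 => [|j _]; last exact: sqr_ge0.
    move=> /allP/(_ i); rewrite mem_index_enum => /(_ isT).
    by rewrite sqrf_eq0 => /eqP.
  rewrite -m0 mulr0 addr0 [X in _ + X]big1 ?addr0; last first.
    by move=> i _; rewrite -(Msym (w i)) -/(a i) a0 !mulr0 addr0.
  apply: (IH (fun i j => P (w i) (w j)) (fun i j => M (w i) (w j))) => //.
  by move=> z; have := Mform z 0; rewrite mulr0 mul0r expr0n mulr0 !addr0.
pose S i j := M (w i) (w j) - a i * a j / m.
have S_ge0 (z : nat -> R) : 0 <= \sum_(i < n) \sum_(j < n) S i j * (z i * z j).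
  have := Mform z (- (\sum_(i < n) a i * z i) / m).
  rewrite (_ : \sum_(i < n) \sum_(j < n) S i j * (z i * z j)
    = \sum_(i < n) \sum_(j < n) M (w i) (w j) * (z i * z j)
      - (\sum_(i < n) a i * z i) ^+ 2 / m).
    by congr (0 <= _); field; rewrite gt_eqF.
  rewrite expr2 [(\sum_(i < n) _) * _]mulr_suml mulr_suml -sumrB.
  apply: eq_bigr => i _; rewrite mulr_sumr mulr_suml -sumrB.
  by apply: eq_bigr => j _; rewrite /S; ring.
have PS : 0 <= \sum_(i < n) \sum_(j < n) P (w i) (w j) * S i j.
  apply: (IH (fun i j => P (w i) (w j)) S) => // i j.
  by rewrite /S Msym [a i * _]mulrC.
have Pa : 0 <= (\sum_(i < n) \sum_(j < n) P (w i) (w j) * (a i * a j)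
      + m * \sum_(i < n) (P (w i) ord_max + P ord_max (w i)) * a i
      + P ord_max ord_max * m ^+ 2) / m.
  apply: divr_ge0; last exact: ltW.
  have := Pge0 (ext za m); rewrite form.
  congr (0 <= _); congr (_ + _ * _ + _); apply: eq_bigr => i _; last by rewrite zaE.
  by apply: eq_bigr => j _; rewrite !zaE.
have := addr_ge0 PS Pa; congr (0 <= _).
rewrite !mulrDl addrA addrA; congr (_ + _ + _).
- rewrite mulr_suml -big_split /=; apply: eq_bigr => i _.
  rewrite mulr_suml -big_split /=; apply: eq_bigr => j _.
  by rewrite /S; ring.
- rewrite [m * _]mulrC mulfK ?gt_eqF //; apply: eq_bigr => i _.
  by rewrite -(Msym (w i)) -/(a i) mulrDl.
- by field; rewrite gt_eqF.
Qed.

End PositiveForms.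

(** * Kernels tested against BDF2 differences *)

Definition bdf2_diff {R : pzRingType} (v : nat -> R) (k : nat) : R :=
  3 * v k - 4 * v (k - 1)%N + v (k - 2)%N.

(** Coefficient of [v k - v i] in [\sum_j W k j * (v j.+1 - v j)]. *)
Definition col_diff {R : pzRingType} (W : nat -> nat -> R) (k i : nat) : R :=
  if i is i'.+1 then W k i - W k i' else W k 0%N.

(** For a kernel that depends on [k - i] only, [col_diff] is a first difference of
    the kernel and [row_drop] a second one. *)
Definition row_drop {R : pzRingType} (W : nat -> nat -> R) (k i : nat) : R :=
  col_diff W k i - col_diff W k.+1 i.

Lemma sum_col_diff {R : pzRingType} (W : nat -> nat -> R) (k m : nat) :
  \sum_(i < m.+1) col_diff W k i = W k m.
Proof.
elim: m => [|m IH]; first by rewrite big_ord_recr big_ord0 /= add0r.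
by rewrite big_ord_recr /= IH addrC subrK.
Qed.

(** With [m = l], a triangular sum over increments becomes a combination of the
    chords [v l - v i]; for each [i] these chords have the same BDF2 differences
    as [v] itself. *)
Lemma sum_by_parts {R : comPzRingType} (W : nat -> nat -> R) (v : nat -> R)
    (l m : nat) :
  \sum_(j < m) W l j * (v j.+1 - v j) =
  \sum_(i < m) col_diff W l i * (v m - v i).
Proof.
elim: m => [|m IH]; first by rewrite !big_ord0.
rewrite big_ord_recr /= IH -(sum_col_diff W l m) mulr_suml.
rewrite [in LHS]big_ord_recr [in RHS]big_ord_recr /= addrA -big_split /=.
by congr (_ + _); apply: eq_bigr => i _; rewrite -mulrDr addrC addrA subrK.
Qed.

Section Kernel.
Variables (R : realFieldType) (W : nat -> nat -> R).
Local Notation d := (col_diff W).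
Local Notation eps := (row_drop W).
Hypothesis d_ge0 : forall k i, (i < k)%N -> 0 <= d k i.
Hypothesis eps_ge0 : forall k i, (i < k)%N -> 0 <= eps k i.
Hypothesis eps_decr : forall k i, (i < k)%N -> eps k.+1 i <= 3 * eps k i.
Hypothesis d_diag : forall k, (0 < k)%N ->
  d k.+1 k <= 2 * \sum_(i < k) eps k i.

(** The energy is a sum over [i] of BDF2 norms of the chords from [i].  Its
    growth, [col_diff W n.+1 i] times an increment of the norm, is summed by
    parts in [n].  The chord from [n] itself enters with the norm
    [(v n - v n.-1) ^+ 2], which has to be paid for by the other chords: from
    [T_n^2 + (2 T_n - T_(n-1))^2 + T_(n-1)^2 = 3 T_n^2 + 2 (T_n - T_(n-1))^2]
    the total weight of this square is [2 * \sum_i row_drop W n i], whence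
    [d_diag].  The last sum on the left is what makes the induction close. *)
Lemma kernel_energy (v : nat -> R) n :
  \sum_(i < n) d n i * ((v n - v i) ^+ 2
      + (2 * (v n - v i) - (v (n - 1)%N - v i)) ^+ 2)
  + \sum_(i < n) eps n i * (v (n - 1)%N - v i) ^+ 2
  <= 2 * \sum_(k < n)
    (\sum_(j < k.+1) W k.+1 j * (v j.+1 - v j)) * bdf2_diff v k.+1.
Proof.
elim: n => [|n IH]; first by rewrite !big_ord0 mulr0 addr0.
rewrite [in leRHS]big_ord_recr /= mulrDr.
apply: le_trans (lerD IH (lexx _)).
rewrite sum_by_parts /bdf2_diff !subSS subn0 !subn1.
set x := v n - v n.-1.
(* The BDF2 identity for the chord from each i. *)
have -> : 2 * ((\sum_(i < n.+1) d n.+1 i * (v n.+1 - v i))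
              * (3 * v n.+1 - 4 * v n + v n.-1))
  = \sum_(i < n.+1) d n.+1 i * ((v n.+1 - v i) ^+ 2
      + (2 * (v n.+1 - v i) - (v n - v i)) ^+ 2)
  - \sum_(i < n.+1) d n.+1 i * ((v n - v i) ^+ 2
      + (2 * (v n - v i) - (v n.-1 - v i)) ^+ 2)
  + (\sum_(i < n.+1) d n.+1 i) * (v n.+1 - 2 * v n + v n.-1) ^+ 2.
  rewrite mulr_suml mulr_sumr -sumrB mulr_suml -big_split /=.
  by apply: eq_bigr => i _; ring.
rewrite [X in _ <= _ + (_ - X + _)]big_ord_recr /=.
rewrite [X in _ + X <= _]big_ord_recr /=.
have D2 : 0 <= (\sum_(i < n.+1) d n.+1 i) * (v n.+1 - 2 * v n + v n.-1) ^+ 2.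
  by rewrite mulr_ge0 ?sqr_ge0 ?sumr_ge0 // => i _; rewrite d_ge0.
suff key : \sum_(i < n) eps n.+1 i * (v n - v i) ^+ 2 + d n.+1 n * x ^+ 2
  <= \sum_(i < n) eps n i * ((v n - v i) ^+ 2
      + (2 * (v n - v i) - (v n.-1 - v i)) ^+ 2)
  + \sum_(i < n) eps n i * (v n.-1 - v i) ^+ 2.
  have E : \sum_(i < n) d n i * ((v n - v i) ^+ 2
      + (2 * (v n - v i) - (v n.-1 - v i)) ^+ 2)
    = \sum_(i < n) d n.+1 i * ((v n - v i) ^+ 2
      + (2 * (v n - v i) - (v n.-1 - v i)) ^+ 2)
    + \sum_(i < n) eps n i * ((v n - v i) ^+ 2
      + (2 * (v n - v i) - (v n.-1 - v i)) ^+ 2).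
    by rewrite -big_split; apply: eq_bigr => i _ /=; rewrite /row_drop; ring.
  rewrite E; move: key D2; rewrite /x.
  rewrite (_ : (v n - v n) ^+ 2 + (2 * (v n - v n) - (v n.-1 - v n)) ^+ 2
             = (v n - v n.-1) ^+ 2); last by ring.
  by rewrite [X in eps _ _ * X](_ : _ = 0); [lra | ring].
have -> : \sum_(i < n) eps n i * ((v n - v i) ^+ 2
      + (2 * (v n - v i) - (v n.-1 - v i)) ^+ 2)
  + \sum_(i < n) eps n i * (v n.-1 - v i) ^+ 2
  = \sum_(i < n) (3 * eps n i) * (v n - v i) ^+ 2
    + (2 * \sum_(i < n) eps n i) * x ^+ 2.
  rewrite -big_split mulr_sumr mulr_suml -big_split /=.
  apply: eq_bigr => i _; rewrite /x /=; ring.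
apply: lerD.
  by apply: ler_sum => i _; rewrite ler_wpM2r ?sqr_ge0 ?eps_decr.
case: (posnP n) => [n0|n_gt0]; last by rewrite ler_wpM2r ?sqr_ge0 ?d_diag.
by rewrite /x n0 subrr expr0n !mulr0.
Qed.

Lemma kernel_bdf2_ge0 (v : nat -> R) n :
  0 <= \sum_(k < n)
    (\sum_(j < k.+1) W k.+1 j * (v j.+1 - v j)) * bdf2_diff v k.+1.
Proof.
rewrite -(pmulr_rge0 _ (ltr0Sn R 1)); apply: le_trans (kernel_energy v n).
apply: addr_ge0; apply: sumr_ge0 => i _; apply: mulr_ge0.
- exact: d_ge0.
- by rewrite addr_ge0 ?sqr_ge0.
- exact: eps_ge0.
- exact: sqr_ge0.
Qed.

End Kernel.

Definition nabla {R : pzRingType} (f : nat -> R) (n : nat) : R := f n - f n.+1.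

Definition completely_monotone {R : numDomainType} (f : nat -> R) :=
  forall m j, 0 <= iter m nabla f j.

(** A convolution kernel [e + c] whose first column lacks [c], as no
    interpolant reaches before the initial time; [b] is added to the first diagonal
    entry only. *)
Definition conv_kernel {R : pzRingType} (e c : nat -> R) (b : R) (k j : nat) : R :=
  if j is _.+1 then e (k - j.+1)%N + c (k - j.+1)%N
  else e (k - 1)%N + b *+ (k == 1%N).

(** The bound on [e 1 + c 0] is the condition on the first two steps, which
    monotonicity alone does not imply because of the missing [c]. *)
Lemma conv_kernel_bdf2_ge0 {R : realFieldType} (e c : nat -> R) (b : R) :
  completely_monotone e -> completely_monotone c -> 0 <= b ->
  e 1%N + c 0%N <= e 0%N + 2 * b ->
  forall (v : nat -> R) n,
  0 <= \sum_(k < n) (\sum_(j < k.+1) conv_kernel e c b k.+1 j * (v j.+1 - v j))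
                    * bdf2_diff v k.+1.
Proof.
move=> cme cmc b_ge0 e0c v n.
have e_ge0 p : 0 <= e p by exact: (cme 0%N p).
have c_ge0 p : 0 <= c p by exact: (cmc 0%N p).
have e1 p : 0 <= e p - e p.+1 by exact: (cme 1%N p).
have c1 p : 0 <= c p - c p.+1 by exact: (cmc 1%N p).
have e2 p : 0 <= (e p - e p.+1) - (e p.+1 - e p.+2) by exact: (cme 2%N p).
have c2 p : 0 <= (c p - c p.+1) - (c p.+1 - c p.+2) by exact: (cmc 2%N p).
have e3 p : 0 <= ((e p - e p.+1) - (e p.+1 - e p.+2))
    - ((e p.+1 - e p.+2) - (e p.+2 - e p.+3)) by exact: (cme 3%N p).
have c3 p : 0 <= ((c p - c p.+1) - (c p.+1 - c p.+2))
    - ((c p.+1 - c p.+2) - (c p.+2 - c p.+3)) by exact: (cmc 3%N p).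
set W := conv_kernel e c b.
have col0 p : col_diff W p.+1 0 = e p + b *+ (p == 0%N).
  by rewrite /W /= subn1.
have col1 p : col_diff W p.+2 1 = e p + c p - e p.+1.
  by rewrite /W /= !subSS !subn0 mulr0n addr0.
have colS p i : col_diff W (p + i.+3) i.+2 = e p + c p - (e p.+1 + c p.+1).
  rewrite /W /= addnK [(p + i.+3)%N]addnS -addSn.
  by rewrite (_ : (p.+1 + i.+2 - i.+2 = p.+1)%N) ?addnK.
(* The two columns that see the lack of c are treated apart. *)
have case_col (P : nat -> nat -> Prop) :
    (forall p, P p.+1 0%N) -> (forall p, P p.+2 1%N) ->
    (forall p i, P (p + i.+3)%N i.+2) -> forall k i, (i < k)%N -> P k i.
  move=> P0 P1 PS [//|k] [|[|i]] ik; first exact: P0.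
    by case: k ik.
  by rewrite -(subnK ik); exact: PS.
apply: kernel_bdf2_ge0.
- apply: case_col => [p|p|p i]; rewrite ?col0 ?col1 ?colS.
  + by rewrite addr_ge0 ?mulrn_wge0.
  + by have := e1 p; have := c_ge0 p; lra.
  + by have := e1 p; have := c1 p; lra.
- apply: case_col => [p|p|p i]; rewrite /row_drop -?addSn ?col0 ?col1 ?colS.
  + by have := e1 p; case: p => [|p] /=; rewrite ?mulr1n ?mulr0n; lra.
  + by have := e2 p; have := c1 p; lra.
  + by have := e2 p; have := c2 p; lra.
- apply: case_col => [p|p|p i]; rewrite /row_drop -?addSn ?col0 ?col1 ?colS.
  + by have := e1 p; have := e2 p; case: p => [|p] /=;
      rewrite ?mulr1n ?mulr0n; lra.
  + by have := e2 p; have := c1 p; have := e3 p; have := c2 p; lra.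
  + by have := e2 p; have := c2 p; have := e3 p; have := c3 p; lra.
- case=> [//|[_|k _]].
    rewrite col1 big_ord1 /row_drop !col0 mulr1n mulr0n.
    by have := e1 0%N; lra.
  rewrite sumrB !sum_col_diff -[k.+3]/(0 + k.+3)%N colS /W /=.
  rewrite subnn subSnn.
  by have := e1 0%N; have := c1 0%N; lra.
Qed.

(** Remainder of the L2 operator after its convolution part.  One half of the
    surplus [alpha / 2] of the first step is left here, which makes the form
    below nonnegative; the other half is the [b] of [conv_kernel]. *)
Definition local_term {R : unitRingType} (alpha : R) (v : nat -> R)
    (k : nat) : R :=
  if k is 0%N then alpha / 4 * (v 1%N - v 0%N)
  else alpha * (v k.+1 - v k) - alpha / 2 * (v k - v k.-1).

(** With [x], [y] two consecutive increments,
    [(2 x - y) (3 x - y) = 5/2 (x - y)^2 + 7/2 x^2 - 3/2 y^2], so that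
    [3/4 * alpha] times the last squared increment is a lower bound. *)
Lemma local_term_bdf2_ge0 {R : realFieldType} (alpha : R) (v : nat -> R) n :
  0 <= alpha -> 0 <= \sum_(k < n) local_term alpha v k * bdf2_diff v k.+1.
Proof.
move=> a_ge0.
suff H : 3 / 4 * alpha * (v n - v n.-1) ^+ 2
    <= \sum_(k < n) local_term alpha v k * bdf2_diff v k.+1.
  by apply: le_trans H; rewrite mulr_ge0 ?sqr_ge0 // mulr_ge0 // divr_ge0.
elim: n => [|[|n] IH]; first by rewrite big_ord0 subrr expr0n mulr0.
  by rewrite big_ord_recr big_ord0 /= /bdf2_diff /= le_eqVlt; apply/orP; left;
    apply/eqP; field.
rewrite big_ord_recr /=; apply: le_trans (lerD IH (lexx _)).
rewrite /bdf2_diff /= !subSS !subn0 -subr_ge0.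
set x := v n.+2 - v n.+1; set y := v n.+1 - v n.
rewrite (_ : 3 * v n.+2 - 4 * v n.+1 + v n = 3 * x - y); last by rewrite /x /y; ring.
rewrite (_ : _ - _ = alpha * (x ^+ 2 + 5 / 4 * (x - y) ^+ 2)); last by field.
by rewrite mulr_ge0 // addr_ge0 ?sqr_ge0 // mulr_ge0 ?sqr_ge0 // divr_ge0.
Qed.

(** * Recovering BDF2 differences from a triangular operator *)

Section TriangularInverse.
Context {R : realFieldType}.

(** A lower triangular operator [S] with nonzero diagonal determines the
    increments of [v], hence its BDF2 differences.  The matrix [P] so obtained
    inherits the sign of the form [S v * bdf2_diff v], since every vector is
    [S v] for some [v]. *)
Lemma bdf2_from_triangular n (A : nat -> nat -> R) :
  (forall k, A k k != 0) ->
  let S v k := \sum_(j < k.+1) A k j * (v j.+1 - v j) in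
  (forall v : nat -> R, 0 <= \sum_(k < n) S v k * bdf2_diff v k.+1) ->
  exists P : 'I_n -> 'I_n -> R,
    (forall (v : nat -> R) (k : 'I_n), bdf2_diff v k.+1 = \sum_j P k j * S v j)
    /\ (forall y : nat -> R, 0 <= \sum_i \sum_j P i j * (y i * y j)).
Proof.
move=> A0 S Sge0.
pose MA : 'M[R]_n := \matrix_(i, j) (if (j <= i)%N then A i j else 0).
have uMA : MA \in unitmx.
  rewrite unitmxE det_trig.
    by rewrite unitfE; apply/prodf_neq0 => i _; rewrite mxE leqnn.
  apply/is_trig_mxP => i j ij; by rewrite mxE leqNgt ij.
pose Inv := invmx MA.
have SE v (k : 'I_n) : S v k = \sum_j MA k j * (v j.+1 - v j).
  rewrite /S (big_ord_widen_cond n predT (fun j => A k j * (v j.+1 - v j))) //.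
  rewrite big_mkcond /=; apply: eq_bigr => j _; rewrite mxE ltnS.
  by case: ifP; rewrite ?mul0r.
have step (x : 'I_n -> R) (i : 'I_n) :
    \sum_(l < n | (l < i.+1)%N) x l - \sum_(l < n | (l < i)%N) x l = x i.
  rewrite (bigD1 i) //=.
  rewrite [X in x i + X](eq_bigl (fun l : 'I_n => (l < i)%N)) ?addrK //.
  by move=> l; rewrite ltnS ltn_neqAle andbC -val_eqE.
(* V j is the sequence starting at 0 for which S is the j-th unit vector. *)
pose V (j : 'I_n) (m : nat) := \sum_(i < n | (i < m)%N) Inv i j.
exists (fun k j => bdf2_diff (V j) k.+1).
have PE v k : bdf2_diff v (@nat_of_ord n k).+1
    = \sum_j bdf2_diff (V j) k.+1 * S v j.
  have xE i : v (@nat_of_ord n i).+1 - v i = \sum_j Inv i j * S v j.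
    pose x := \col_(l < n) (v l.+1 - v l).
    have -> : v i.+1 - v i = x i ord0 by rewrite mxE.
    rewrite -[x](mulKmx uMA) mxE; apply: eq_bigr => j _; congr (_ * _).
    by rewrite SE mxE; apply: eq_bigr => l _; rewrite !mxE.
  have vE m : (m <= n)%N -> v m = v 0%N + \sum_j V j m * S v j.
    elim: m => [|m IHm] mn.
      rewrite big1 ?addr0 // => j _; rewrite /V big_pred0 ?mul0r //.
    have {1}-> : v m.+1 = v m + (v m.+1 - v m) by rewrite addrC subrK.
    have xm : v m.+1 - v m = \sum_j Inv (Ordinal mn) j * S v j.
      exact: xE (Ordinal mn).
    rewrite xm IHm 1?ltnW // -addrA -big_split /=; congr (_ + _).
    apply: eq_bigr => j _; rewrite -mulrDl; congr (_ * _).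
    have /eqP := step (Inv^~ j) (Ordinal mn).
    by rewrite subr_eq addrC => /eqP.
  have kn : (k <= n)%N by exact: ltnW.
  have k1n : (k - 1 <= n)%N by exact: leq_trans (leq_subr _ _) kn.
  rewrite /bdf2_diff !subSS subn0 (vE k.+1) // (vE k) // (vE (k - 1)%N) //.
  rewrite [RHS](_ : _ = 3 * (\sum_j V j k.+1 * S v j)
    - 4 * (\sum_j V j k * S v j) + \sum_j V j (k - 1)%N * S v j); first by ring.
  rewrite !mulr_sumr -sumrB -big_split /=; apply: eq_bigr => j _.
  by ring.
split=> // y.
pose x := Inv *m \col_(j < n) y j.
pose v m := \sum_(l < n | (l < m)%N) x l ord0.
have Sv (k : 'I_n) : S v k = y k.
  rewrite SE; under eq_bigr do rewrite step.
  have -> : y k = (MA *m x) k ord0 by rewrite /x mulKVmx // mxE.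
  by rewrite mxE.
have := Sge0 v; congr (0 <= _); apply: eq_bigr => k _.
rewrite PE mulr_sumr Sv; apply: eq_bigr => j _.
by rewrite Sv mulrCA.
Qed.

End TriangularInverse.

(** * Complete monotonicity of the weights of the L2 operator *)

Section CM.
Context {R : realType}.
Implicit Types (f g : R -> R) (s x y : R).

Definition unit_drop f s : R := f s - f (s + 1).

Definition derives_pos f f' := forall s, 0 < s -> is_derive s 1 f (f' s).

Lemma derives_pos_continuous f f' x :
  derives_pos f f' -> 0 < x -> {for x, continuous f}.
Proof.
move=> ff' x0; apply/differentiable_continuous/derivable1_diffP.
by have [] := ff' _ x0.
Qed.

Lemma mean_value_pos f f' x y : derives_pos f f' -> 0 < x -> x < y ->
  exists c, [/\ x < c, c < y & f y - f x = f' c * (y - x)].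
Proof.
move=> ff' x0 xy; have [||c] := @MVT R f f' x y xy.
- move=> z; rewrite in_itv /= => /andP[xz _]; apply: ff'; exact: lt_trans xz.
- apply: continuous_in_subspaceT => {}z; rewrite inE /= in_itv /= => /andP[xz _].
  by apply: derives_pos_continuous ff' _; exact: lt_le_trans xz.
- by rewrite in_itv /= => /andP[xc cy] E; exists c.
Qed.

Lemma mean_value_nneg f f' x y : derives_pos f f' ->
  f s @[s --> 0^'+] --> f 0 -> 0 <= x -> x < y ->
  exists c, [/\ x < c, c < y & f y - f x = f' c * (y - x)].
Proof.
move=> ff' f0 x0 xy; have [||c] := @MVT R f f' x y xy.
- move=> z; rewrite in_itv /= => /andP[xz _]; apply: ff'; exact: le_lt_trans xz.
- suff : {within [set` `[0, +oo[], continuous f}.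
    apply: continuous_subspaceW.
    move=> {}z /=; rewrite !in_itv /= andbT => /andP[xz _].
    exact: le_trans xz.
  apply/continuous_within_itvcyP; split=> // z'.
  by rewrite in_itv /= andbT => /(derives_pos_continuous ff').
- by rewrite in_itv /= => /andP[xc cy] E; exists c.
Qed.

Lemma derives_pos_drop f f' m :
  derives_pos f f' -> derives_pos (iter m unit_drop f) (iter m unit_drop f').
Proof.
move=> ff'; elim: m => [//|m IH] s s0.
have d1 : is_derive s (1 : R) (id + cst (1 : R)) (1 + 0) by exact: is_deriveD.
have d2 := @is_derive1_comp _ (iter m unit_drop f) (id + cst (1 : R)) s _ _
  (IH (s + 1) (addr_gt0 s0 ltr01)) d1.
rewrite addr0 mulr1 in d2.
exact: (is_deriveB (IH _ s0) d2).
Qed.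

(** Right continuity at 0 is needed for the weight of index 0, where the
    derivatives of [s `^ (1 - alpha)] blow up. *)
Lemma right_continuous_drop f f' m : derives_pos f f' ->
  f s @[s --> 0^'+] --> f 0 ->
  iter m unit_drop f s @[s --> 0^'+] --> iter m unit_drop f 0.
Proof.
move=> ff' f0; elim: m => [//|m IH] /=.
rewrite {2}/unit_drop; apply: (cvgB IH).
have c1 : {for (0 + 1), continuous (iter m unit_drop f)}.
  apply: derives_pos_continuous (derives_pos_drop m ff') _.
  by rewrite add0r.
apply: (@cvg_comp _ _ _ (fun s : R => s + 1) _ _ (nbhs (0 + 1 : R))); last exact: c1.
apply: cvgD; [|exact: cvg_cst].
by apply: cvg_at_right_filter; exact: cvg_id.
Qed.

Lemma iter_dropZ (a : R) f m s :
  iter m unit_drop (fun t => a * f t) s = a * iter m unit_drop f s.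
Proof. by elim: m s => [//|m IH] s; rewrite /= /unit_drop !IH mulrBr. Qed.

(** Complete monotonicity of [t `^ (- b)]: the derivative of its [m]-th difference
    is [- b] times the [m]-th difference of [t `^ (- (b + 1))], so the next
    difference is nonnegative by the mean value theorem. *)
Lemma drop_powRN_ge0 m (b s : R) : 0 <= b -> 0 < s ->
  0 <= iter m unit_drop (fun t => t `^ (- b)) s.
Proof.
elim: m b s => [|m IH] b s b0 s0; first exact: powR_ge0.
have dp : derives_pos (fun t : R => t `^ (- b)) (fun t => - b * t `^ (- (b + 1))).
  by move=> t t0; rewrite opprD; exact: is_derive1_powR.
have [c [sc _ E]] := mean_value_pos (derives_pos_drop m dp) s0
  (ltr_pwDr ltr01 (lexx s)).
rewrite /= {1}/unit_drop -opprB E iter_dropZ addrAC subrr add0r mulr1 mulNr opprK.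
by rewrite mulr_ge0 // IH ?addr_ge0 // (lt_trans s0).
Qed.

(** The integral over [t] in [0, 1] of [(1/2 + t) f''(s + t)], integrated by
    parts when [f'] is the derivative of [f]. *)
Definition right_rule f f' s : R :=
  (f' (s + 1) - f' s) / 2 + (f' (s + 1) - (f (s + 1) - f s)).

Definition trapezoid_error f f' s : R :=
  (f (s + 1) - f s) - (f' (s + 1) + f' s) / 2.

(** Differences commute with both rules, so their signs follow from those of the
    differences of [f]. *)
Lemma iter_drop_right_rule f f' m s :
  iter m unit_drop (right_rule f f') s =
  right_rule (iter m unit_drop f) (iter m unit_drop f') s.
Proof.
by elim: m s => [//|m IH] s; rewrite /= /unit_drop !IH /right_rule /=; field.
Qed.

Lemma iter_drop_trapezoid f f' m s :
  iter m unit_drop (trapezoid_error f f') s =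
  trapezoid_error (iter m unit_drop f) (iter m unit_drop f') s.
Proof.
by elim: m s => [//|m IH] s; rewrite /= /unit_drop !IH /trapezoid_error /=; field.
Qed.

Lemma right_rule_ge0 f f' f'' s : derives_pos f f' -> derives_pos f' f'' ->
  f t @[t --> 0^'+] --> f 0 -> f' t @[t --> 0^'+] --> f' 0 ->
  (forall t, 0 < t -> 0 <= f'' t) -> 0 <= s -> 0 <= right_rule f f' s.
Proof.
move=> ff' f'f'' f0 f'0 f''0 s0.
have incr x y : 0 <= x -> x < y -> f' x <= f' y.
  move=> x0 xy; have [c [xc _ E]] := mean_value_nneg f'f'' f'0 x0 xy.
  rewrite -subr_ge0 E mulr_ge0 ?subr_ge0 ?(ltW xy) // f''0 //.
  exact: le_lt_trans xc.
have ss1 : s < s + 1 by rewrite ltrDl.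
have [c [sc cs1 E]] := mean_value_nneg ff' f0 s0 ss1.
rewrite /right_rule E (_ : s + 1 - s = 1) ?mulr1; last by rewrite addrAC subrr add0r.
have := incr _ _ s0 ss1; have := incr _ _ (le_trans s0 (ltW sc)) cs1; lra.
Qed.

Lemma trapezoid_error_ge0 f f' f'' s : derives_pos f f' -> derives_pos f' f'' ->
  (forall x y, 0 < x -> x <= y -> f'' y <= f'' x) ->
  0 < s -> 0 <= trapezoid_error f f' s.
Proof.
move=> ff' f'f'' decr s0.
(* The error of the rule on [s, t], as a function of t, starts at 0. *)
pose tau t := (f t - f s) - (t - s) * (f' t + f' s) / 2.
have dtau : derives_pos tau
    (fun t => f' t - ((f' t + f' s) + (t - s) * f'' t) / 2).
  move=> t t0; have d1 := ff' t t0; have d2 := f'f'' t t0.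
  have -> : tau = (f - cst (f s)) - 2^-1 *: ((id - cst s) * (f' + cst (f' s))).
    apply/funext => z; rewrite /tau /= !fctE /= [_ *: _]mulrC.
    by [].
  apply: is_derive_eq; rewrite /= !fctE /= !subr0 !addr0.
  by rewrite /GRing.scale /= mulr1; ring.
have ss1 : s < s + 1 by rewrite ltrDl.
have [c [sc cs1 E]] := mean_value_pos dtau s0 ss1.
have -> : trapezoid_error f f' s = tau (s + 1).
  by rewrite /trapezoid_error /tau; field.
have [x [sx xc F]] := mean_value_pos f'f'' s0 sc.
have c0 := lt_trans s0 sc; have x0 := lt_trans s0 sx.
have tau0 : tau s = 0 by rewrite /tau !subrr !mul0r subr0.
move: E; rewrite tau0 subr0 (_ : s + 1 - s = 1) ?mulr1 => [->|]; last by ring.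
rewrite (_ : _ - _ = ((f' c - f' s) - (c - s) * f'' c) / 2); last by field.
rewrite F (_ : _ - _ = (c - s) * (f'' x - f'' c)); last by ring.
rewrite divr_ge0 // mulr_ge0 ?subr_ge0 ?(ltW sc) //.
by rewrite decr ?(ltW xc).
Qed.

End CM.

Section Weights.
Context {R : realType}.
Variable alpha : R.
Hypothesis alpha01 : 0 < alpha < 1.

Let F (s : R) := s `^ (2 - alpha).
Let F' (s : R) := (2 - alpha) * s `^ (1 - alpha).
Let F'' (s : R) := (2 - alpha) * (1 - alpha) * s `^ (- alpha).

Let scaled_powR_derive (a p : R) :
  derives_pos (fun s => a * s `^ p) (fun s => a * (p * s `^ (p - 1))).
Proof.
move=> s s0; have dp := is_derive1_powR p s0.
exact: (@is_deriveZ _ _ _ (fun t : R => t `^ p) a s 1 _ dp).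
Qed.

Let F_derive : derives_pos F F'.
Proof.
move=> s s0; rewrite /F' (_ : 1 - alpha = 2 - alpha - 1); last by ring.
exact: is_derive1_powR.
Qed.

Let F'_derive : derives_pos F' F''.
Proof.
move=> s s0; have := scaled_powR_derive (2 - alpha) (1 - alpha) s0.
by rewrite mulrA (_ : 1 - alpha - 1 = - alpha) //; ring.
Qed.

Let F_right0 : F s @[s --> 0^'+] --> F 0.
Proof.
have [a0 a1] := andP alpha01.
by rewrite /F powR0; [apply: powR_cvg0; lra | lra].
Qed.

Let F'_right0 : F' s @[s --> 0^'+] --> F' 0.
Proof.
have [a0 a1] := andP alpha01.
rewrite {2}/F' powR0; last by lra.
by apply: cvgM; [exact: cvg_cst | apply: powR_cvg0; lra].
Qed.

Let drop_F''_ge0 m s : 0 < s -> 0 <= iter m unit_drop F'' s.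
Proof.
move=> s0; have [a0 a1] := andP alpha01.
by rewrite iter_dropZ !mulr_ge0 ?drop_powRN_ge0 // ?ltW //; lra.
Qed.

Let drop_F''_decr m x y : 0 < x -> x <= y ->
  iter m unit_drop F'' y <= iter m unit_drop F'' x.
Proof.
have [a0 a1] := andP alpha01.
move=> x0; rewrite le_eqVlt => /predU1P[-> //|xy].
have d : derives_pos F''
    (fun s => - ((2 - alpha) * (1 - alpha) * alpha) * s `^ (- (alpha + 1))).
  move=> s s0.
  have := scaled_powR_derive ((2 - alpha) * (1 - alpha)) (- alpha) s0.
  by rewrite mulrA mulrN opprD.
have [c [xc _ E]] := mean_value_pos (derives_pos_drop m d) x0 xy.
rewrite -subr_le0 E iter_dropZ mulr_le0_ge0 ?subr_ge0 ?(ltW xy) //.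
rewrite mulr_le0_ge0 ?drop_powRN_ge0 ?(lt_trans x0) //; last lra.
by rewrite oppr_le0 !mulr_ge0 //; lra.
Qed.

Let L2_aE j : L2_a alpha j = - right_rule F F' j%:R.
Proof. by rewrite /L2_a /right_rule /F /F' -(natr1 j); field. Qed.

Let L2_cE j : L2_c alpha j = trapezoid_error F F' j%:R.
Proof. by rewrite /L2_c /trapezoid_error /F /F' -(natr1 j); field. Qed.

Lemma L2_a_monotone : completely_monotone (fun j => - L2_a alpha j).
Proof.
move=> m j; suff -> : iter m nabla (fun i => - L2_a alpha i) j
    = iter m unit_drop (right_rule F F') j%:R.
  rewrite iter_drop_right_rule.
  apply: right_rule_ge0 (derives_pos_drop m F_derive)
    (derives_pos_drop m F'_derive) _ _ _ _ => //.
  - exact: right_continuous_drop F_derive F_right0.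
  - exact: right_continuous_drop F'_derive F'_right0.
  - exact: drop_F''_ge0.
elim: m j => [|m IH] j; first by rewrite /= L2_aE opprK.
by rewrite /= /nabla /unit_drop !IH natr1.
Qed.

Lemma L2_c_monotone : completely_monotone (fun j => L2_c alpha j.+1).
Proof.
move=> m j; suff -> : iter m nabla (fun i => L2_c alpha i.+1) j
    = iter m unit_drop (trapezoid_error F F') j.+1%:R.
  rewrite iter_drop_trapezoid.
  apply: trapezoid_error_ge0 (derives_pos_drop m F_derive)
    (derives_pos_drop m F'_derive) _ _ => //.
  exact: drop_F''_decr.
elim: m j => [|m IH] j; first by rewrite /= L2_cE.
by rewrite /= /nabla /unit_drop !IH natr1.
Qed.

(** The difference of the two sides is [2 (2 - alpha) (1 - 2 `^ (- alpha))]. *)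
Lemma L2_first_column : - L2_a alpha 1 + L2_c alpha 1 <= - L2_a alpha 0 + alpha / 2.
Proof.
have [a0 a1] := andP alpha01.
have E : (2 : R) `^ (2 - alpha) = 2 ^+ 2 * 2 `^ (- alpha).
  rewrite powRD ?powR_mulrn //; by apply/implyP; rewrite pnatr_eq0.
have E' : (2 : R) `^ (1 - alpha) = 2 * 2 `^ (- alpha).
  rewrite powRD ?powRr1 //; by apply/implyP; rewrite pnatr_eq0.
rewrite /L2_a /L2_c !powR1 !powR0 ?E ?E'; try lra.
have p1 : (2 : R) `^ (- alpha) <= 1.
  by rewrite -[leRHS](powRr0 2) ler_powR ?ler1n // oppr_le0 ltW.
have : 0 <= (2 - alpha) * (1 - 2 `^ (- alpha)).
  by apply: mulr_ge0; rewrite subr_ge0 //; lra.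
lra.
Qed.

End Weights.

(** * The Gamma function *)

Section GammaFunction.
Context {R : realType}.
Local Notation mu := (@lebesgue_measure R).

Let expRN_derive (t : R) : is_derive t 1 (fun u : R => expR (- u)) (- expR (- t)).
Proof.
have := @is_derive1_comp R expR -%R t _ _ (is_derive_expR (- t)) (is_deriveNid t 1).
by rewrite mulrN1.
Qed.

Let expRN_continuous : continuous (fun u : R => expR (- u)).
Proof.
move=> t; apply/differentiable_continuous/derivable1_diffP.
by have [] := expRN_derive t.
Qed.

(** [- q t * expR (- t)] is a primitive of the integrand; the integrand is required
    to be nonnegative so that no integrability has to be known beforehand. *)
Lemma integral_expR_decay (q q' : R -> R) (K : R) :
  derives_pos q q' ->
  (forall t : R, 0 < t -> {for t, continuous q'}) ->
  q t @[t --> 0^'+] --> q 0 -> q' t @[t --> 0^'+] --> q' 0 ->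
  (forall t : R, 0 <= t -> 0 <= q t <= K * (1 + t ^+ 2)) ->
  (forall t : R, 0 <= t -> q' t <= q t) ->
  (\int[mu]_(t in `[0%R, +oo[) ((q t - q' t) * expR (- t))%:E = (q 0)%:E)%E.
Proof.
move=> dq cq' q0 q'0 qK q'q.
have cq (t : R) : 0 < t -> {for t, continuous q}.
  move=> t0; apply/differentiable_continuous/derivable1_diffP.
  by have [] := dq t t0.
have dF (t : R) : 0 < t -> is_derive t 1 (fun u => - (q u * expR (- u)))
    ((q t - q' t) * expR (- t)).
  move=> t0; have d1 := dq t t0; have d2 := expRN_derive t.
  have := is_deriveN (is_deriveM d1 d2).
  rewrite (_ : - (_ + _) = (q t - q' t) * expR (- t)) //.
  by rewrite /GRing.scale /=; ring.
rewrite (@ge0_continuous_FTC2y _ _ (fun u => - (q u * expR (- u))) 0 0).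
- by rewrite oppr0 expR0 mulr1 sub0e EFinN oppeK.
- by move=> t t0; rewrite mulr_ge0 ?expR_ge0 // subr_ge0 q'q.
- apply/continuous_within_itvcyP; split.
    move=> t; rewrite in_itv /= andbT => t0.
    apply: cvgM; last exact: expRN_continuous.
    by apply: cvgB; [exact: cq | exact: cq'].
  apply: cvgM; first exact: cvgB.
  by apply: cvg_at_right_filter; exact: expRN_continuous.
- rewrite -oppr0; apply: cvgN.
  have e2 : expR (- (t / 2)) @[t --> +oo] --> (0 : R).
    have half : t / 2 @[t --> +oo] --> (+oo : set_system R).
      by apply: gt0_cvgMly; rewrite ?invr_gt0.
    exact: (cvg_comp _ (fun u : R => expR (- u)) half (@cvgr_expR R)).
  have e3 : (8 * K) * expR (- (t / 2)) @[t --> +oo] --> (0 : R).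
    by rewrite -(mulr0 (8 * K)); apply: cvgM => //; exact: cvg_cst.
  apply: (squeeze_cvgr _ (cvg_cst 0) e3); near=> t.
  have t0 : 0 <= t by near: t; exact: nbhs_pinfty_ge.
  have /andP[qt0 qtK] := qK t t0.
  rewrite mulr_ge0 ?expR_ge0 //= (_ : - t = - (t / 2) - t / 2); last by field.
  rewrite expRD mulrA ler_wpM2r ?expR_ge0 // expRN ler_pdivrMr ?expR_gt0 //.
  apply: le_trans qtK _.
  have K0 : 0 <= K.
    have /andP[+ /le_trans] := qK 0 (lexx _); rewrite expr0n addr0 mulr1.
    by move=> h1 h2; exact: le_trans h1 (h2 _ _).
  have := @expR_ge1Dxn _ (t / 2) 1 (divr_ge0 t0 (ler0n _ 2)).
  rewrite (_ : (2`!)%:R = 2 :> R) // => h.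
  rewrite mulrAC [leRHS]mulrC ler_wpM2l //.
  have := sqr_ge0 t; nra.
- by move=> t t0; have [] := dF t t0.
- apply: cvgN; apply: cvgM => //.
  by apply: cvg_at_right_filter; exact: expRN_continuous.
- move=> t; rewrite in_itv /= andbT => t0; rewrite derive1E.
  exact: (@derive_val _ _ _ _ _ _ _ (dF t t0)).
Unshelve. all: by end_near.
Qed.

Let I (p : R) := (\int[mu]_(t in `[0%R, +oo[) (t `^ p * expR (- t))%:E)%E.

Let derives_posD (f f' : R -> R) (a : R) :
  derives_pos f f' -> derives_pos (fun t => f t + a) f'.
Proof.
move=> ff' t t0; have := is_deriveD (ff' t t0) (is_derive_cst a t 1).
by rewrite addr0.
Qed.

Let measurable_integrand (p : R) D :
  measurable_fun D (fun t : R => t `^ p * expR (- t)).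
Proof.
apply: (@measurable_funS _ _ _ _ setT) => //; apply: measurable_funM.
  exact: measurable_powR.
by apply: measurableT_comp => //; exact: measurable_funN.
Qed.

Let powR_le1D (p t : R) : 0 <= p <= 1 -> 0 <= t -> t `^ p <= 1 + t.
Proof.
move=> /andP[p0 p1] t0; have [t1|t1] := leP t 1.
  apply: (@le_trans _ _ 1); last by rewrite lerDl.
  have := @ge0_ler_powR _ p p0 t 1; rewrite powR1 !nnegrE; exact.
apply: (@le_trans _ _ t); last by rewrite lerDr.
by rewrite -[leRHS]powRr1 // ler_powR // ltW.
Qed.

(** The bound is the integral of (t + 1) exp(-t), with q = t + 2. *)
Let I_fin (p : R) : 0 <= p <= 1 -> I p \is a fin_num.
Proof.
move=> p01; rewrite ge0_fin_numE; last first.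
  by apply: integral_ge0 => t _; rewrite lee_fin mulr_ge0 ?powR_ge0 ?expR_ge0.
apply: (@le_lt_trans _ _
  (\int[mu]_(t in `[0%R, +oo[) (((t + 2) - 1) * expR (- t))%:E)%E).
  apply: ge0_le_integral => //.
  - by move=> t _; rewrite lee_fin mulr_ge0 ?powR_ge0 ?expR_ge0.
  - by apply/measurable_EFinP; exact: measurable_integrand.
  - apply/measurable_EFinP/measurable_funM; last first.
      by apply: measurableT_comp => //; exact: measurable_funN.
    by apply: measurable_funB => //; apply: measurable_funD.
  - move=> t; rewrite /= in_itv /= andbT => t0.
    rewrite lee_fin ler_wpM2r ?expR_ge0 //.
    by apply: le_trans (powR_le1D p01 t0) _; lra.
rewrite (@integral_expR_decay (fun t => t + 2) (fun=> 1) 3) ?ltry //.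
- by apply: derives_posD => t _; exact: is_derive_id.
- by move=> t _; exact: cst_continuous.
- apply: cvgD; last exact: cvg_cst.
  by apply: cvg_at_right_filter; exact: cvg_id.
- exact: cvg_cst.
- move=> t t0; apply/andP; split; first lra.
  by have := sqr_ge0 (t - 1 / 2); have := sqr_ge0 t; nra.
- by move=> t t0; lra.
Qed.

Let I0 : I 0 = 1%E.
Proof.
transitivity (\int[mu]_(t in `[0%R, +oo[)
    ((cst 1%R t - cst 0%R t) * expR (- t))%:E)%E.
  by apply: eq_integral => t _; rewrite /= subr0 powRr0.
apply: (@integral_expR_decay (cst 1) (cst 0) 1).
- by move=> t _; exact: is_derive_cst.
- by move=> t _; exact: cst_continuous.
- exact: cvg_cst.
- exact: cvg_cst.
- by move=> t t0; rewrite ler01 mul1r lerDl sqr_ge0.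
- by [].
Qed.

(** The derivative of - t^(p+1) exp(-t) changes sign; adding 6 to t^(p+1) makes
    it nonnegative, and 6 times the integral of exp(-t) is removed afterwards. *)
Let I_rec (p : R) : 0 < p <= 1 -> I (p + 1) = ((p + 1)%:E * I p)%E.
Proof.
move=> /andP[p0 p1].
have p01 : 0 <= p <= 1 by rewrite (ltW p0).
have powR_rate (t : R) : 0 <= t -> (p + 1) * t `^ p <= t `^ (p + 1) + 6.
  move=> t0; rewrite powRD; last first.
    by apply/implyP; rewrite gt_eqF // addr_gt0.
  rewrite powRr1 //; have [t2|t2] := leP 2 t.
    have := powR_ge0 t p; nra.
  have := powR_le1D p01 t0; have := powR_ge0 t p; nra.
have H : (\int[mu]_(t in `[0%R, +oo[)
    (((t `^ (p + 1) + 6) - (p + 1) * t `^ p) * expR (- t))%:E = 6%:E)%E.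
  rewrite (@integral_expR_decay (fun t => t `^ (p + 1) + 6) _ 7).
  - by rewrite powR0 ?add0r // gt_eqF // addr_gt0.
  - apply: derives_posD => t t0; have := @is_derive1_powR R (p + 1) t t0.
    by rewrite addrK.
  - move=> t t0; apply: cvgM; first exact: cvg_cst.
    suff : {for t, continuous (fun u : R => u `^ p)} by [].
    apply/differentiable_continuous/derivable1_diffP.
    by have [] := @is_derive1_powR R p t t0.
  - apply: cvgD; last exact: cvg_cst.
    by rewrite powR0 ?gt_eqF ?addr_gt0 //; apply: powR_cvg0; rewrite addr_gt0.
  - apply: cvgM; first exact: cvg_cst.
    by rewrite powR0 ?gt_eqF //; exact: powR_cvg0.
  - move=> t t0; apply/andP; split; first by rewrite addr_ge0 ?powR_ge0.
    have := powR_le1D p01 t0; rewrite powRD; last first.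
      by apply/implyP; rewrite gt_eqF // addr_gt0.
    rewrite powRr1 // => h; have := ler_wpM2r t0 h; have := sqr_ge0 (t - 1); nra.
  - exact: powR_rate.
have pos (x : R) : (forall t : R, `[0%R, +oo[%classic t ->
    0%E <= (t `^ x * expR (- t))%:E)%E.
  by move=> t _; rewrite lee_fin mulr_ge0 ?powR_ge0 ?expR_ge0.
have meas (x : R) : measurable_fun (`[0%R, +oo[%classic : set R)
    (fun t : R => (t `^ x * expR (- t))%:E).
  by apply/measurable_EFinP; exact: measurable_integrand.
have mD : measurable (`[0%R, +oo[%classic : set R) by exact: measurable_itv.
have Z1 (x y t : R) : (0 <= x)%R -> `[0%R, +oo[%classic t ->
    (0 <= x%:E * (t `^ y * expR (- t))%:E)%E.
  by move=> x0 t0; rewrite mule_ge0 ?pos.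
have p10 : (0 <= p + 1)%R by rewrite addr_ge0 // ltW.
suff E : (I (p + 1) + 6%:E * I 0 = 6%:E + (p + 1)%:E * I p)%E.
  move: E; rewrite I0 mule1 [RHS]addeC => E.
  by rewrite -[LHS](@addeK _ 6%:E) // E addeK.
rewrite -(ge0_integralZl_EFin mu mD (pos 0) (meas 0) (ler0n _ 6)).
rewrite -(ge0_integralD mu mD (pos _) (meas _)
  (fun t => @Z1 6 0 t (ler0n _ 6)) (measurable_funeM 6%:E (meas 0))).
rewrite -[X in _ = (X + _)%E]H -(ge0_integralZl_EFin mu mD (pos p) (meas p) p10).
rewrite -(ge0_integralD mu mD _ _ (fun t => @Z1 _ p t p10)
  (measurable_funeM (p + 1)%:E (meas p))).
- by apply: eq_integral => t _; rewrite powRr0 -!EFinM -!EFinD; congr EFin; ring.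
- move=> t; rewrite /= in_itv /= andbT => t0.
  by rewrite lee_fin mulr_ge0 ?expR_ge0 // subr_ge0 powR_rate.
- apply/measurable_EFinP/measurable_funM; last first.
    by apply: measurableT_comp => //; exact: measurable_funN.
  apply: measurable_funB.
    apply: measurable_funD => //.
    by apply: measurable_funTS; exact: measurable_powR.
  apply: measurable_funM => //.
  by apply: measurable_funTS; exact: measurable_powR.
Qed.

Let I_gt0 (p : R) : 0 <= p <= 1 -> (0 < I p)%E.
Proof.
move=> /andP[p0 p1].
have E2 : (\int[mu]_(t in `[1%R, 2%R]) (expR (- 2))%:E = (expR (- 2))%:E)%E.
  rewrite integral_cst //= lebesgue_measure_itv /= lte_fin ltr1n /=.
  by rewrite -EFinD -EFinM (_ : 2 - 1 = 1 :> R) ?mulr1 //; ring.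
apply: (@lt_le_trans _ _ (expR (- 2))%:E); first by rewrite lte_fin expR_gt0.
rewrite -E2; apply: (@le_trans _ _
  (\int[mu]_(t in `[1%R, 2%R]) (t `^ p * expR (- t))%:E)%E).
  apply: ge0_le_integral => //.
  - by apply/measurable_EFinP; exact: measurable_integrand.
  - move=> t; rewrite /= in_itv /= => /andP[t1 t2]; rewrite lee_fin.
    rewrite -[leLHS]mul1r ler_pM ?expR_ge0 // ?ler_expR ?lerN2 //.
    by rewrite -(powRr0 t) ler_powR.
apply: ge0_subset_integral => //.
- by apply/measurable_EFinP; exact: measurable_integrand.
- by move=> t _; rewrite lee_fin mulr_ge0 ?powR_ge0 ?expR_ge0.
- move=> t; rewrite /= !in_itv /= andbT => /andP[t1 _].
  exact: (le_trans ler01 t1).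
Qed.

(** The bounds t^p <= 1 + t used above restrict p = s - 1 to [0, 1]. *)
Lemma GammaS (s : R) : 1 < s <= 2 -> Gamma (s + 1) = s * Gamma s.
Proof.
move=> /andP[s1 s2]; rewrite /Gamma /Rintegral.
have := @I_rec (s - 1); rewrite /I !subrK addrK => -> //; last by apply/andP; split; lra.
rewrite fineM // -/(I (s - 1)) I_fin //; apply/andP; split; lra.
Qed.

Lemma Gamma_gt0 (s : R) : 1 <= s <= 2 -> 0 < Gamma s.
Proof.
move=> /andP[s1 s2]; have s01 : 0 <= s - 1 <= 1 by apply/andP; split; lra.
rewrite /Gamma /Rintegral -/(I (s - 1)) fine_gt0 // I_gt0 //=.
by rewrite -ge0_fin_numE ?I_fin // ltW // I_gt0.
Qed.

End GammaFunction.

(** * The L2 operator as a triangular kernel *)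

Section L2Operator.
Context {R : realType}.
Variable alpha : R.
Hypothesis alpha01 : 0 < alpha < 1.

(** Up to a constant factor, the coefficient of the increment [v j.+1 - v j] in
    [L2_op] at step [k.+1]. *)
Definition L2_kernel (k j : nat) : R :=
  conv_kernel (fun i => - L2_a alpha i) (fun i => L2_c alpha i.+1) (alpha / 4)
    k.+1 j
  + if k is 0%N then alpha / 4
    else alpha *+ (j == k) - alpha / 2 *+ (j.+1 == k).

Lemma sum_local_kernel (v : nat -> R) k :
  \sum_(j < k.+1) (if k is 0%N then alpha / 4
      else alpha *+ (j == k :> nat) - alpha / 2 *+ (j.+1 == k)) * (v j.+1 - v j)
  = local_term alpha v k.
Proof.
case: k => [|k]; first by rewrite big_ord1.
rewrite !big_ord_recr big1 => [|j _] /=; last first.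
  have jk := ltn_ord j.
  by rewrite eqSS (ltn_eqF jk) (ltn_eqF (ltnW jk : j < k.+1)%N) !mulr0n subrr mul0r.
rewrite !eqxx ltn_eqF // gtn_eqF // !mulr0n !mulr1n; ring.
Qed.

Lemma L2_kernelE (v : nat -> R) k :
  \sum_(j < k.+1) L2_kernel k j * (v j.+1 - v j)
  = \sum_(j < k.+1) conv_kernel (fun i => - L2_a alpha i)
      (fun i => L2_c alpha i.+1) (alpha / 4) k.+1 j * (v j.+1 - v j)
    + local_term alpha v k.
Proof.
rewrite -sum_local_kernel -big_split; apply: eq_bigr => j _ /=.
by rewrite -mulrDl.
Qed.

Lemma L2_a0E : - L2_a alpha 0 = 2 - 3 / 2 * alpha.
Proof.
have [a0 a1] := andP alpha01.
by rewrite /L2_a !powR1 !powR0; [field | lra | lra].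
Qed.

Lemma L2_kernel_bdf2_ge0 (v : nat -> R) n :
  0 <= \sum_(k < n)
    (\sum_(j < k.+1) L2_kernel k j * (v j.+1 - v j)) * bdf2_diff v k.+1.
Proof.
have [a0 a1] := andP alpha01.
under eq_bigr do rewrite L2_kernelE mulrDl.
rewrite big_split; apply: addr_ge0; last exact: local_term_bdf2_ge0 (ltW a0).
apply: conv_kernel_bdf2_ge0.
- exact: L2_a_monotone.
- exact: L2_c_monotone.
- by rewrite divr_ge0 ?ltW.
- by have := L2_first_column alpha01; lra.
Qed.

Lemma L2_kernel_diag_neq0 k : L2_kernel k k != 0.
Proof.
have [a0 a1] := andP alpha01; rewrite gt_eqF // /L2_kernel /conv_kernel.
have e0 := L2_a_monotone alpha01 0%N 0%N; have c0 := L2_c_monotone alpha01 0%N 0%N.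
rewrite /= in e0 c0.
case: k => [|k] /=; first by rewrite mulr1n; lra.
by rewrite !subSS subnn eqxx gtn_eqF // mulr1n mulr0n; lra.
Qed.

(** Since [a_j + b_j + c_j = 0], each quadratic interpolant contributes
    [c_j] times one increment and [- a_j] times the previous one.  The recursion
    of Gamma brings the first step to the common factor. *)
Lemma L2_opE (dt : R) (v : nat -> R) k :
  L2_op alpha dt v k.+1 = (Gamma (3 - alpha) * dt `^ alpha)^-1 *
    \sum_(j < k.+1) L2_kernel k j * (v j.+1 - v j).
Proof.
have [a0 a1] := andP alpha01.
have Gpos : 0 < Gamma (2 - alpha) by apply: Gamma_gt0; apply/andP; split; lra.
have G3 : Gamma (3 - alpha) = (2 - alpha) * Gamma (2 - alpha).
  rewrite -GammaS; last by apply/andP; split; lra.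
  by congr Gamma; ring.
case: k => [|k].
  rewrite big_ord1 /L2_kernel /= mulr1n L2_a0E G3 /= !invfM.
  have h : 2 - alpha != 0 by rewrite gt_eqF //; lra.
  transitivity ((2 - alpha)^-1 * (2 - alpha)
      * ((Gamma (2 - alpha))^-1 * (dt `^ alpha)^-1 * (v 1%N - v 0%N))).
    by rewrite mulVf // mul1r.
  by move: (2 - alpha)^-1 (Gamma _)^-1 (dt `^ alpha)^-1 => p q s; field.
rewrite L2_kernelE /L2_op; congr (_ * _).
have abc j : L2_b alpha j = - L2_a alpha j - L2_c alpha j.
  by rewrite /L2_a /L2_b /L2_c -(natr1 j); field.
(* The sum over lags j becomes a sum over increments. *)
rewrite big_add1 big_mkord (reindex_inj rev_ord_inj) /=.
transitivity (\sum_(j < k.+1) (- L2_a alpha (k.+1 - j) * (v j.+1 - v j)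
      + L2_c alpha (k - j).+1 * (v j.+2 - v j.+1))
    + (- L2_a alpha 0) * (v k.+2 - v k.+1)
    + (alpha * (v k.+2 - v k.+1) - alpha / 2 * (v k.+1 - v k))).
  rewrite L2_a0E.
  rewrite (eq_bigr (fun j : 'I_k.+1 => - L2_a alpha (k.+1 - j) * (v j.+1 - v j)
      + L2_c alpha (k - j).+1 * (v j.+2 - v j.+1))) => [|j _].
    by rewrite !subSS !subn0; field.
  have jk : (j <= k)%N by rewrite -ltnS.
  rewrite subSS (subSn jk) abc subSS (subSn (leq_subr _ _)) (subKn jk) subn1 addn1.
  by rewrite /=; ring.
congr (_ + _).
rewrite [in LHS]big_split /= -addrA [X in _ + X]addrC addrA.
rewrite [RHS]big_ord_recl /conv_kernel /= mulr0n addr0 subSS subn0.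
under [in RHS]eq_bigr do rewrite !subSS mulrDl.
rewrite big_split addrA; congr (_ + _).
rewrite [in LHS]big_ord_recl subn0 -addrA; congr (_ + _).
rewrite [RHS]big_ord_recr /= subnn; congr (_ + _).
Qed.

End L2Operator.

(** * Operators on periodic square-integrable functions *)

Section PeriodicL2.
Context {R : realType} {d : nat}.
Variables lo hi : 'I_d -> R.
Local Notation mu := (@lebesgue_tuple R d).
Local Notation Om := (box lo hi).
Local Notation L2 := (L2per lo hi).
Local Notation fT := (d.-tuple R -> R).
Implicit Types (f g h : fT) (D : set fT) (A : fT -> fT).

Lemma measurable_box : measurable Om.
Proof.
rewrite [X in measurable X](_ : _ = \big[setI/setT]_(i < d)
    ((fun t : d.-tuple R => tnth t i) @^-1` `[lo i, hi i]%classic)).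
  apply: bigsetI_measurable => i _; rewrite -[X in measurable X]setTI.
  exact: measurable_tnth.
apply/seteqP; split => x /=.
  move=> bx; apply: (big_ind (fun B : set (d.-tuple R) => B x)) => //.
  by move=> i _; rewrite /= in_itv /=; exact: bx.
rewrite -bigcap_seq /= => bx i.
by have := bx i; rewrite /= mem_index_enum in_itv /=; apply.
Qed.

Let mbox := measurable_box.

Lemma L2per_measurable f : L2 f -> measurable_fun Om f.
Proof. by case=> mf _ _; apply: measurable_funTS. Qed.

Lemma L2per_mul_integrable f g : L2 f -> L2 g ->
  mu.-integrable Om (fun x => (f x * g x)%:E).
Proof.
move=> Lf Lg; have [_ _ If] := Lf; have [_ _ Ig] := Lg.
apply: (le_integrable mbox _ _ (integrableD mbox If Ig)).
  by apply/measurable_EFinP; apply: measurable_funM; exact: L2per_measurable.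
move=> x _ /=; rewrite lee_fin.
rewrite (ger0_norm (addr_ge0 (sqr_ge0 _) (sqr_ge0 _))) ler_norml.
have := sqr_ge0 (f x - g x); have := sqr_ge0 (f x + g x).
have := sqr_ge0 (f x); have := sqr_ge0 (g x).
by rewrite sqrrB sqrrD => *; apply/andP; split; lra.
Qed.

Lemma L2per_linear (c : R) f g : L2 f -> L2 g -> L2 (fun x => c * f x + g x).
Proof.
move=> Lf Lg; have [mf pf If] := Lf; have [mg pg Ig] := Lg; split.
- by apply: measurable_funD => //; apply: measurable_funM.
- by move=> i x; rewrite pf pg.
- have Ifg := L2per_mul_integrable Lf Lg.
  have := integrableD mbox (integrableD mbox (integrableZl mbox (c ^+ 2) If)
    (integrableZl mbox (2 * c) Ifg)) Ig.
  congr (mu.-integrable _ _); apply/funext => x /=.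
  by rewrite -!EFinM -!EFinD; congr EFin; ring.
Qed.

Lemma innerC f g : inner lo hi f g = inner lo hi g f.
Proof. by apply: eq_Rintegral => x _; rewrite mulrC. Qed.

Lemma inner_linearl (c : R) f g h : L2 f -> L2 g -> L2 h ->
  inner lo hi (fun x => c * f x + g x) h = c * inner lo hi f h + inner lo hi g h.
Proof.
move=> Lf Lg Lh; have Ifh := L2per_mul_integrable Lf Lh.
rewrite /inner -(RintegralZl c mbox Ifh) -RintegralD //.
- by apply: eq_Rintegral => x _; rewrite mulrDl mulrA.
- exact: (integrableZl mbox c Ifh).
- exact: L2per_mul_integrable.
Qed.

Lemma eq_inner_ae f g h : L2 f -> L2 g -> L2 h ->
  g = h %[ae mu in Om] -> inner lo hi f g = inner lo hi f h.
Proof.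
move=> Lf Lg Lh gh; congr fine; apply: ae_eq_integral => //.
- by apply/measurable_EFinP; apply: measurable_funM; exact: L2per_measurable.
- by apply/measurable_EFinP; apply: measurable_funM; exact: L2per_measurable.
- by apply: filterS gh => x /= gh bx; rewrite gh.
Qed.

Definition lincomb n (y : nat -> R) (f : nat -> fT) : fT :=
  fun x => \sum_(i < n) y i * f i x.

Lemma lincombS n y (f : nat -> fT) :
  lincomb n.+1 y f = (fun x => y n * f n x + lincomb n y f x).
Proof. by apply/funext => x; rewrite /lincomb big_ord_recr /= addrC. Qed.

Lemma lincomb0 y (f : nat -> fT) : lincomb 0 y f = (fun=> 0).
Proof. by apply/funext => x; rewrite /lincomb big_ord0. Qed.

Lemma L2per0 : L2 (fun=> 0).
Proof.
split=> //; under eq_fun do rewrite expr0n /=.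
exact: integrable0.
Qed.

Lemma L2per_lincomb n y (f : nat -> fT) :
  (forall i, (i < n)%N -> L2 (f i)) -> L2 (lincomb n y f).
Proof.
elim: n => [|n IH] Lf; first by rewrite lincomb0; exact: L2per0.
rewrite lincombS; apply: L2per_linear; first exact: Lf.
by apply: IH => i /ltnW; exact: Lf.
Qed.

Lemma inner_lincomb n y (f : nat -> fT) h :
  (forall i, (i < n)%N -> L2 (f i)) -> L2 h ->
  inner lo hi (lincomb n y f) h = \sum_(i < n) y i * inner lo hi (f i) h.
Proof.
move=> Lf Lh; elim: n Lf => [|n IH] Lf.
  rewrite lincomb0 big_ord0 /inner; under eq_Rintegral do rewrite mul0r.
  by rewrite /Rintegral integral0.
have Lf' i : (i < n)%N -> L2 (f i) by move/ltnW; exact: Lf.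
rewrite lincombS (inner_linearl _ (Lf n (ltnSn n)) (L2per_lincomb y Lf') Lh).
by rewrite IH // big_ord_recr /= addrC.
Qed.

Section Operator.
Variables (D : set fT) (A : fT -> fT).
Hypothesis linA : linear_operator lo hi D A.

Lemma domain_lincomb n y (f : nat -> fT) :
  (forall i, (i < n)%N -> D (f i)) -> D (lincomb n y f).
Proof.
have [[_ D0 Dlin _] _ _] := linA.
elim: n => [|n IH] Df; first by rewrite lincomb0.
rewrite lincombS; apply: Dlin; first exact: Df.
by apply: IH => i /ltnW; exact: Df.
Qed.

(** An operator that is linear modulo null sets maps [0] to [0] only almost
    everywhere, which is the case [n = 0]. *)
Lemma operator_lincomb n y (f : nat -> fT) :
  (forall i, (i < n)%N -> D (f i)) ->
  A (lincomb n y f) = lincomb n y (fun i => A (f i)) %[ae mu in Om].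
Proof.
have [[_ D0 Dlin _] _ Alin] := linA.
elim: n => [|n IH] Df.
  have E0 : (fun x : d.-tuple R => -1 * 0 + 0) = (fun=> 0 : R).
    by apply/funext => z; rewrite mulr0 addr0.
  rewrite !lincomb0; apply: filterS (Alin (-1) _ _ D0 D0) => x /= E bx.
  by move: (E bx); rewrite E0 => ->; rewrite mulN1r addNr.
have Df' i : (i < n)%N -> D (f i) by move/ltnW; exact: Df.
rewrite !lincombS.
have := Alin (y n) _ _ (Df n (ltnSn n)) (domain_lincomb y Df').
apply: filterS2 (IH Df') => x /= E1 E2 bx.
by rewrite (E2 bx) (E1 bx).
Qed.

Lemma domain_L2 f : D f -> L2 f.
Proof. by have [[DL2 _ _ _] _ _] := linA; exact: DL2. Qed.

Lemma range_L2 f : D f -> L2 (A f).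
Proof. by have [_ AL2 _] := linA; exact: AL2. Qed.

Lemma form_lincomb n y z (f : nat -> fT) :
  (forall i, (i < n)%N -> D (f i)) ->
  inner lo hi (lincomb n y f) (A (lincomb n z f)) =
  \sum_(i < n) \sum_(j < n) y i * z j * inner lo hi (f i) (A (f j)).
Proof.
move=> Df; have Lf i : (i < n)%N -> L2 (f i) by move/Df/domain_L2.
have LAf i : (i < n)%N -> L2 (A (f i)) by move/Df/range_L2.
have LA : L2 (A (lincomb n z f)) by apply/range_L2/domain_lincomb.
rewrite (inner_lincomb y Lf LA); apply: eq_bigr => i _.
rewrite (eq_inner_ae (Lf _ (ltn_ord i)) LA (L2per_lincomb z LAf)
  (operator_lincomb z Df)).
rewrite innerC (inner_lincomb z LAf (Lf _ (ltn_ord i))) mulr_sumr.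
by apply: eq_bigr => j _; rewrite innerC mulrA.
Qed.

End Operator.

(** The square of the BDF2 norm (the G-norm of multistep theory) of
    [(u m, u (m - 1))] for the form of [A]. *)
Definition g_norm A (u : nat -> fT) m : R :=
  let w : fT := fun x => 2 * u m x - u (m - 1)%N x in
  inner lo hi (u m) (A (u m)) + inner lo hi w (A w).

(** The defect is the form of [A] at the second difference of [u]. *)
Lemma g_norm_dissipation D A (u : nat -> fT) n :
  linear_operator lo hi D A -> formally_self_adjoint lo hi D A ->
  nonneg_operator lo hi D A -> (forall i, D (u (n - i)%N)) ->
  g_norm A u n - g_norm A u (n - 1)%N <= 2 * inner lo hi (A (u n)) (bdf2 u n).
Proof.
move=> linA symA posA Du.
(* Every function involved is a combination of u^n, u^(n-1) and u^(n-2). *)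
pose f i := u (n - i)%N.
have Df i : (i < 3)%N -> D (f i) by move=> _; exact: Du.
pose cf (a b c : R) (i : nat) := nth 0 [:: a; b; c] i.
have combE a b c : lincomb 3 (cf a b c) f
    = (fun x => a * u n x + b * u (n - 1)%N x + c * u (n - 2)%N x).
  by apply/funext => x; rewrite /lincomb !big_ord_recr big_ord0 /= add0r /f subn0.
have sym i j : inner lo hi (f i) (A (f j)) = inner lo hi (f j) (A (f i)).
  by rewrite innerC (symA _ _ (Du j) (Du i)).
have formE a b c a' b' c' :
    inner lo hi (lincomb 3 (cf a b c) f) (A (lincomb 3 (cf a' b' c') f)) =
    a * a' * inner lo hi (f 0%N) (A (f 0%N)) + b * b' * inner lo hi (f 1%N) (A (f 1%N))
    + c * c' * inner lo hi (f 2%N) (A (f 2%N))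
    + (a * b' + b * a') * inner lo hi (f 0%N) (A (f 1%N))
    + (a * c' + c * a') * inner lo hi (f 0%N) (A (f 2%N))
    + (b * c' + c * b') * inner lo hi (f 1%N) (A (f 2%N)).
  rewrite (form_lincomb linA) // !big_ord_recr !big_ord0 /= !add0r.
  by rewrite (sym 1%N 0%N) (sym 2%N 0%N) (sym 2%N 1%N) /cf /=; ring.
have un : u n = lincomb 3 (cf 1 0 0) f.
  by rewrite combE; apply/funext => x; ring.
have un1 : u (n - 1)%N = lincomb 3 (cf 0 1 0) f.
  by rewrite combE; apply/funext => x; ring.
have wn : (fun x => 2 * u n x - u (n - 1)%N x) = lincomb 3 (cf 2 (-1) 0) f.
  by rewrite combE; apply/funext => x; ring.
have wn1 : (fun x => 2 * u (n - 1)%N x - u (n - 1 - 1)%N x) = lincomb 3 (cf 0 2 (-1)) f.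
  by rewrite combE; apply/funext => x; rewrite -subnDA; ring.
have bn : bdf2 u n = lincomb 3 (cf 3 (-4) 1) f.
  by rewrite combE; apply/funext => x; rewrite /bdf2; ring.
have := posA _ (domain_lincomb linA (cf 1 (-2) 1) Df).
rewrite (innerC (A (u n))) bn /g_norm wn wn1 un un1 !formE; lra.
Qed.

End PeriodicL2.

(** * Dissipation of the modified energy *)

(** The Gram matrix of [- A] is symmetric positive semidefinite. *)
Lemma nonpos_operator_pairing {R : realType} {d : nat} (lo hi : 'I_d -> R) D A n
    (P : 'I_n -> 'I_n -> R) (f : nat -> d.-tuple R -> R) :
  linear_operator lo hi D A -> formally_self_adjoint lo hi D A ->
  nonpos_operator lo hi D A -> (forall i, (i < n)%N -> D (f i)) ->
  (forall y : nat -> R, 0 <= \sum_i \sum_j P i j * (y i * y j)) ->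
  \sum_i \sum_j P i j * inner lo hi (f i) (A (f j)) <= 0.
Proof.
move=> linA symA negA Df Pge0; rewrite -oppr_ge0.
pose M (i j : 'I_n) := - inner lo hi (f i) (A (f j)).
have -> : - (\sum_i \sum_j P i j * inner lo hi (f i) (A (f j)))
    = \sum_i \sum_j P i j * M i j.
  rewrite -sumrN; apply: eq_bigr => i _; rewrite -sumrN.
  by apply: eq_bigr => j _; rewrite mulrN.
apply: pairing_nonneg_forms_ge0 => // [i j|y].
  by rewrite /M -(symA _ _ (Df _ (ltn_ord i)) (Df _ (ltn_ord j))) innerC.
have := negA _ (domain_lincomb linA y Df).
rewrite (form_lincomb linA y y Df) -oppr_ge0 -sumrN; congr (0 <= _).
apply: eq_bigr => i _; rewrite -sumrN; apply: eq_bigr => j _.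
by rewrite /M mulNr mulrC.
Qed.

Lemma r_dissipation {R : realFieldType} (a b c : R) :
  (a ^+ 2 + (2 * a - b) ^+ 2) - (b ^+ 2 + (2 * b - c) ^+ 2)
  <= 2 * a * (3 * a - 4 * b + c).
Proof. by have := sqr_ge0 (a - 2 * b + c); nra. Qed.

Unset Implicit Arguments.
Set Strict Implicit.
Set Printing Implicit Defensive.

Theorem theorem3p1 (R : realType) (d : nat) (lo hi : 'I_d -> R)
    (alpha T : R) (N : nat)
    (DG DL : set (d.-tuple R -> R))
    (G L : (d.-tuple R -> R) -> (d.-tuple R -> R))
    (E1 : (d.-tuple R -> R) -> R)
    (dE1 : (d.-tuple R -> R) -> (d.-tuple R -> R))
    (u : nat -> d.-tuple R -> R) (r : nat -> R) :
  let dt := T / N%:R in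
  let ubar := extrapolation u in
  let mu (n : nat) : d.-tuple R -> R := fun x =>
    L (u n) x + r n / Num.sqrt (E1 (ubar n)) * dE1 (ubar n) x in
  (0 < d)%N -> (forall i, lo i < hi i) ->
  0 < alpha < 1 -> 0 < T -> (1 <= N)%N ->
  linear_operator lo hi DG G -> formally_self_adjoint lo hi DG G ->
  nonpos_operator lo hi DG G ->
  linear_operator lo hi DL L -> formally_self_adjoint lo hi DL L ->
  nonneg_operator lo hi DL L ->
  (forall n, (n <= N)%N -> DL (u n)) ->
  (forall n, (1 <= n <= N)%N ->
    [/\ 0 < E1 (ubar n),
        functional_derivative lo hi DL E1 (ubar n) (dE1 (ubar n))
      & DG (mu n)]) ->
  (forall n, (1 <= n <= N)%N ->
    (fun x => L2_op alpha dt (fun k => u k x) n) = G (mu n)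
      %[ae @lebesgue_tuple R d in box lo hi]) ->
  (forall n, (1 <= n <= N)%N ->
    3 * r n - 4 * r (n - 1)%N + r (n - 2)%N =
    1 / (2 * Num.sqrt (E1 (ubar n)))
    * inner lo hi (dE1 (ubar n)) (bdf2 u n)) ->
  forall n, (1 <= n <= N)%N ->
    modified_energy u r lo hi L n <= modified_energy u r lo hi L 0%N.
Proof.
move=> dt ubar mu d_gt0 lohi alpha01 T_gt0 N_gt0 linG symG negG linL symL posL.
move=> Du scheme flow rstep n /andP[n_gt0 nN].
have [a0 a1] := andP alpha01.
have dt_gt0 : 0 < dt by rewrite divr_gt0 // ltr0n.
have Lu m : (m <= N)%N -> L2per lo hi (u m) by move/Du/(domain_L2 linL).
have LLu m : (m <= N)%N -> L2per lo hi (L (u m)) by move/Du/(range_L2 linL).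
have Dmu m : (1 <= m <= N)%N -> DG (mu m) by case/scheme.
have Lb m : (m <= N)%N -> L2per lo hi (bdf2 u m).
  move=> mN; have mk k : (m - k <= N)%N by rewrite (leq_trans (leq_subr _ _)).
  have := L2per_linear 3 (Lu m mN)
    (L2per_linear (-4) (Lu _ (mk 1%N)) (Lu _ (mk 2%N))).
  by congr (L2per _ _ _); apply/funext => x; rewrite /bdf2; ring.
have step m : (1 <= m <= N)%N ->
    2 * (modified_energy u r lo hi L m - modified_energy u r lo hi L (m - 1)%N)
    <= inner lo hi (mu m) (bdf2 u m).
  move=> m1N; have /andP[m1 mN] := m1N.
  have [E_gt0 [LdE _] _] := scheme m m1N.
  have s_gt0 : 0 < Num.sqrt (E1 (ubar m)) by rewrite sqrtr_gt0.
  have -> : inner lo hi (mu m) (bdf2 u m) = inner lo hi (L (u m)) (bdf2 u m)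
      + 2 * r m * (3 * r m - 4 * r (m - 1)%N + r (m - 2)%N).
    rewrite (rstep m m1N).
    have -> : mu m = (fun x =>
        r m / Num.sqrt (E1 (ubar m)) * dE1 (ubar m) x + L (u m) x).
      by apply/funext => x; rewrite addrC.
    rewrite (inner_linearl _ LdE (LLu m mN) (Lb m mN)) addrC; congr (_ + _).
    by field; rewrite gt_eqF.
  have Dum i : DL (u (m - i)%N) by apply: Du; exact: leq_trans (leq_subr _ _) mN.
  have := g_norm_dissipation linL symL posL Dum.
  have := r_dissipation (r m) (r (m - 1)%N) (r (m - 2)%N).
  rewrite /modified_energy -/(g_norm lo hi L u m) -/(g_norm lo hi L u (m - 1)).
  by rewrite -subnDA; lra.
have [P [PE Pge0]] := bdf2_from_triangular (L2_kernel_diag_neq0 alpha01)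
  (fun v => L2_kernel_bdf2_ge0 alpha01 v n).
pose C := (Gamma (3 - alpha) * dt `^ alpha)^-1.
have C_gt0 : 0 < C.
  rewrite invr_gt0 mulr_gt0 ?powR_gt0 //.
  have -> : 3 - alpha = (2 - alpha) + 1 by ring.
  rewrite GammaS; last by apply/andP; split; lra.
  rewrite mulr_gt0 ?Gamma_gt0 //; last by apply/andP; split; lra.
  lra.
have Dmun i : (i < n)%N -> DG (mu i.+1).
  by move=> i_n; apply: Dmu; rewrite /= (leq_trans i_n).
(* The scheme gives bdf2 u = C^-1 P (G mu) almost everywhere. *)
have test (k : 'I_n) : inner lo hi (mu k.+1) (bdf2 u k.+1)
    = C^-1 * \sum_j P k j * inner lo hi (mu k.+1) (G (mu j.+1)).
  have kN : (k.+1 <= N)%N by exact: leq_trans nN.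
  have Lmu := domain_L2 linG (Dmun k (ltn_ord k)).
  have LG i : (i < n)%N -> L2per lo hi (G (mu i.+1)) by move/Dmun/(range_L2 linG).
  have [y yE] : exists y : nat -> R, forall i : 'I_n, y i = C^-1 * P k i.
    exists (fun l => if insub l is Some i then C^-1 * P k i else 0) => i.
    by rewrite valK.
  have ae : bdf2 u k.+1 = lincomb n y (fun i => G (mu i.+1))
      %[ae @lebesgue_tuple R d in box lo hi].
    have all_ae : {ae @lebesgue_tuple R d, forall x, forall i : 'I_n,
        box lo hi x ->
        L2_op alpha dt (fun m => u m x) i.+1 = G (mu i.+1) x}.
      apply: filter_forall => i.
      by apply: flow; rewrite /= (leq_trans (ltn_ord i)).
    apply: filterS all_ae => x fl bx.
    rewrite -[LHS]/(bdf2_diff (fun m => u m x) k.+1) PE /lincomb.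
    apply: eq_bigr => i _; rewrite -(fl i bx) L2_opE // -/C yE.
    by rewrite [C^-1 * _]mulrC -mulrA mulKf // gt_eqF.
  rewrite (eq_inner_ae Lmu (Lb _ kN) (L2per_lincomb y LG) ae).
  rewrite innerC (inner_lincomb y LG Lmu) mulr_sumr.
  by apply: eq_bigr => i _; rewrite innerC yE mulrA.
have total : \sum_(k < n) inner lo hi (mu k.+1) (bdf2 u k.+1) <= 0.
  under eq_bigr do rewrite test.
  rewrite -mulr_sumr pmulr_rle0; last by rewrite invr_gt0.
  exact: (nonpos_operator_pairing (f := fun i => mu i.+1)
    linG symG negG Dmun Pge0).
suff : 2 * (modified_energy u r lo hi L n - modified_energy u r lo hi L 0%N) <= 0.
  by rewrite pmulr_rle0 // subr_le0.
apply: le_trans total.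
rewrite -(telescope_sumr (modified_energy u r lo hi L) (leq0n n)) big_mkord.
rewrite mulr_sumr.
apply: ler_sum => k _; have := step k.+1; rewrite subSS subn0; apply.
by rewrite /= (leq_trans (ltn_ord k)).
Qed.
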